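(* Let $m\in\mathcal M$ with $d(m)<\infty$, let $d\ge d(m)\vee1$ be an integer and let $\lambda>0$. Define $$\varphi^d_m(\lambda;x)=1+\sum_{k=1}^d\lambda^kG^k_m(x)+\sum_{k=1}^\infty\lambda^{d+k}\,(s\bullet m\bullet)^kG^d_m(x)\qquad(x\ge0).$$ Then: (i) the series defining $\varphi^d_m(\lambda;\cdot)$ converges uniformly on every compact subset of $[0,\infty)$; (ii) the function $u=\varphi^d_m(\lambda;\cdot)-\left(1+\sum_{k=1}^{d-1}\lambda^kG^k_m\right)$ is the unique solution of the integral equation $$u(x)=\lambda^dG^d_m(x)+\lambda\int_0^x(x-y)u(y)\,dm(y);$$ equivalently, $u=\varphi^d_m(\lambda;\cdot)$ is the unique solution of $\frac{d}{dm}\frac{d^+}{dx}u=\lambda u$ with the boundary condition $$u(0)=1,\qquad \lim_{x\to+0}\left(u^+(x)-\Big(\lambda\,m(x)+\sum_{k=1}^{d-1}\lambda^{k}\int_x^1G^k_m(y)\,dm(y)\Big)\right)=0$$ (called the modified Neumann boundary condition).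
   Context: $\mathcal M$ is the set of strictly increasing right-continuous functions $m:(0,\infty)\to\mathbb R$ with $\int_{(0,1]}x\,dm(x)<\infty$ ($dm$ is the Stieltjes measure). Put $\tilde m(x)=m(x)-m(1)$, $G^1_m(x)=\int_0^x\tilde m(y)\,dy$ and, for $k\ge2$, $G^k_m(x)=-\int_0^xdy\int_y^1G^{k-1}_m(z)\,dm(z)$. Integrals $\int_a^bf\,dm$ are over $(a,b]$ if $a\le b$, and $\int_a^b=-\int_b^a$ if $a>b$. One has $(-1)^kG^k_m\ge0$ on $[0,1]$. If $\lim_{x\to+0}m(x)>-\infty$, then $d(m)=0$; otherwise $d(m)=\inf\{k\ge1:\int_0^1(-1)^kG^k_m(x)\,dm(x)<\infty\}$, $\inf\emptyset=\infty$. Notation: $s(x)=x$; for a function $U$ of bounded variation, $U\bullet f(x)=\int_0^xf(y)\,dU(y)$; thus $s\bullet m\bullet f(x)=\int_0^xdy\int_{(0,y]}f(z)\,dm(z)$ and $(s\bullet m\bullet)^k$ is its $k$-fold iterate. $u^+$ and $\frac{d^+}{dx}u$ denote the right derivative. The equation $\frac{d}{dm}\frac{d^+}{dx}u=\lambda u$ means that $u$ is continuous on $[0,\infty)$, is on $(0,\infty)$ an indefinite integral of $u^+$, and satisfies $u^+(b)-u^+(a)=\lambda\int_{(a,b]}u\,dm$ for $0<a<b$. In the integral equation the integral is understood to converge absolutely for every $x\ge 0$.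
   Formalization: The printed boundary condition is false (m(x)=x+1, d=1); its bracket is corrected to λ(m(x)−m(1)) − Σ_{k=1}^{d−1} λ^{k+1}∫_x^1 G^k_m dm, i.e. m becomes m−m(1), the plus sign becomes minus, and λ^k becomes λ^{k+1}. *)

(* Defs.v *)
From HB Require Import structures.
From mathcomp Require Import all_boot all_order all_algebra.
From mathcomp Require Import all_classical all_reals all_analysis.
From mathcomp Require Import measurable_realfun.

Set Implicit Arguments.
Unset Strict Implicit.
Unset Printing Implicit Defensive.

Import Order.TTheory GRing.Theory Num.Theory.
Import numFieldNormedType.Exports.

Local Open Scope classical_set_scope.
Local Open Scope ring_scope.

(* Only the values on (0, +oo) matter: neither the Stieltjes measure below nor
   any other definition looks at [m x] for [x <= 0]. *)
Record rc_increasing (R : realType) := RcIncreasing {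
  rc_fun :> R -> R;
  rc_lt : forall x y, 0 < x -> x < y -> rc_fun x < rc_fun y;
  rc_cvg : forall x, 0 < x -> rc_fun y @[y --> x^'+] --> rc_fun x }.

Section stieltjes.
Context {R : realType}.
Variable m : rc_increasing R.

Definition expstring : R -> R := fun t => m (expR t).

Let expstring_nd : nondecreasing expstring.
Proof.
move=> s t; rewrite le_eqVlt => /predU1P[->//|st].
by apply/ltW/rc_lt; rewrite ?expR_gt0 ?ltr_expR.
Qed.

Let expstring_rc : right_continuous expstring.
Proof.
move=> t; have mt := @rc_cvg R m (expR t) (expR_gt0 t).
apply: cvg_trans mt => A [/= e e0 eA].
have [d /= d0 dA] : nbhs t [set s | `|expR t - expR s| < e].
  exact: (@cvgr_dist_lt _ _ _ _ _ expR _ (@continuous_expR R t) e e0).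
exists d => //= s ds ts; apply: eA; first exact: dA.
by rewrite ltr_expR.
Qed.

HB.instance Definition _ :=
  isCumulative.Build R _ R expstring expstring_nd expstring_rc.

(* Since [m] may tend to -oo at 0+ it need not extend to a cumulative function
   on the line; [dm] on (0, +oo) is obtained by transporting the Stieltjes
   measure of [m \o expR] along [expR]. *)
Definition stieltjes : set (measurableTypeR R) -> \bar R :=
  pushforward (lebesgue_stieltjes_measure expstring)
    (expR : measurableTypeR R -> measurableTypeR R).

Let measurable_exp :
  measurable_fun [set: measurableTypeR R]
    (expR : measurableTypeR R -> measurableTypeR R).
Proof. exact: measurable_expR. Qed.

Let stieltjes0 : stieltjes set0 = 0%E.
Proof. by rewrite /stieltjes /pushforward preimage_set0 measure0. Qed.

Let stieltjes_ge0 A : (0 <= stieltjes A)%E.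
Proof. exact: measure_ge0. Qed.

Let stieltjes_sigma_additive : semi_sigma_additive stieltjes.
Proof.
move=> F mF tF mUF; rewrite /stieltjes /pushforward preimage_bigcup.
apply: measure_semi_sigma_additive.
- by move=> n; rewrite -[X in measurable X]setTI; exact: measurable_exp.
- apply/trivIsetP => /= i j _ _ ij; rewrite -preimage_setI.
  by move/trivIsetP : tF => /(_ _ _ _ _ ij) ->//; rewrite preimage_set0.
- by rewrite -preimage_bigcup -[X in measurable X]setTI; exact: measurable_exp.
Qed.

HB.instance Definition _ := isMeasure.Build _ _ _ stieltjes
  stieltjes0 stieltjes_ge0 stieltjes_sigma_additive.

Lemma stieltjes_itv (a b : R) : 0 < a -> a <= b ->
  stieltjes `]a, b] = (m b - m a)%:E.
Proof.
move=> a0 ab; have b0 := lt_le_trans a0 ab; rewrite /stieltjes /pushforward.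
have -> : (expR : R -> R) @^-1` `]a, b] = [set` `]ln a, ln b]].
  by apply/seteqP; split => x /=;
    rewrite !in_itv/= -(ltr_expR (ln a)) -(ler_expR _ (ln b)) !lnK.
rewrite /lebesgue_stieltjes_measure /measure_extension measurable_mu_extE//=.
  by rewrite wlength_itv_bnd ?ler_ln// /expstring !lnK.
exact: is_ocitv.
Qed.

Lemma stieltjes_le0 : stieltjes `]-oo, 0] = 0%E.
Proof.
rewrite /stieltjes /pushforward (_ : _ @^-1` _ = set0) ?measure0//.
apply/seteqP; split => x //=; rewrite in_itv/= => x0.
by have := lt_le_trans (expR_gt0 x) x0; rewrite ltxx.
Qed.

Lemma stieltjes_sigma_finite : sigma_finite setT stieltjes.
Proof.
exists (fun n => `]-oo, 0] `|` `]n.+1%:R^-1, n.+1%:R]).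
  apply/esym; rewrite -subTset => x _ /=.
  have [x0|x0] := leP x 0; first by exists 0%N => //; left; rewrite /= in_itv.
  exists (maxn (Num.bound x) (Num.bound x^-1)) => //; right; rewrite /= in_itv/=.
  apply/andP; split.
    rewrite invf_plt ?posrE//.
    apply: lt_le_trans (archi_boundP _) _; first by rewrite invr_ge0 ltW.
    by rewrite ler_nat (leq_trans (leq_maxr (Num.bound x) _)).
  apply/ltW/(lt_le_trans (archi_boundP (ltW x0))).
  by rewrite ler_nat (leq_trans (leq_maxl _ (Num.bound x^-1))).
move=> n; split; first exact: measurableU.
apply: le_lt_trans; first exact: measureU2.
rewrite [X in (X + _)%E]stieltjes_le0 add0e [ltLHS]stieltjes_itv ?ltry//.
by rewrite (@le_trans _ _ 1)// ?invf_le1// ler1n.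
Qed.

HB.instance Definition _ :=
  @Measure_isSigmaFinite.Build _ _ _ stieltjes stieltjes_sigma_finite.

End stieltjes.

Section strings.
Context {R : realType}.
Local Notation leb := (@lebesgue_measure R).
Implicit Types (m : rc_increasing R) (u f : R -> R) (k d : nat).

Definition classM m : Prop :=
  (\int[stieltjes m]_(x in `]0%R, 1%R]) x%:E < +oo)%E.

Definition oint m (a b : R) f : R :=
  if a <= b then \int[stieltjes m]_(x in `]a, b]) f x
  else - \int[stieltjes m]_(x in `]b, a]) f x.

Definition tilde m : R -> R := fun x => m x - m 1.

(* G^k_m for k >= 1; the value at k = 0 is never used. *)
Fixpoint G m k : R -> R :=
  match k with
  | 0%N => cst 1
  | 1%N => fun x => \int[leb]_(y in `]0, x]) tilde m y
  | k'.+1 => fun x => - \int[leb]_(y in `]0, x]) oint m y 1 (G m k')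
  end.

Definition sindex m : \bar R :=
  if `[< (-oo < lim ((m x)%:E @[x --> 0^'+]))%E >] then 0%E
  else ereal_inf [set k%:R%:E | k in [set k | (1 <= k)%N /\
    (\int[stieltjes m]_(x in `]0%R, 1%R]) ((-1) ^+ k * G m k x)%:E < +oo)%E]].

(* [dotm m f] is [m • f] and [dots f] is [s • f], where s(x) = x. *)
Definition dotm m f : R -> R := fun x => \int[stieltjes m]_(z in `]0, x]) f z.
Definition dots f : R -> R := fun x => \int[leb]_(y in `]0, x]) f y.

Definition phi_head m (lam : R) (n : nat) : R -> R :=
  fun x => 1 + \sum_(1 <= k < n.+1) lam ^+ k * G m k x.

Definition phi_term m (lam : R) d k : R -> R :=
  fun x => lam ^+ (d + k) * iter k (dots \o dotm m) (G m d) x.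

Definition phi m (lam : R) d : R -> R :=
  fun x => phi_head m lam d x
           + limn (fun n => \sum_(1 <= k < n) phi_term m lam d k x).

(* Functions on [0, +oo) are represented by functions on R, whose values at
   negative reals are irrelevant. *)
Definition unique_solution (P : (R -> R) -> Prop) u : Prop :=
  P u /\ forall v, P v -> forall x, 0 <= x -> v x = u x.

Definition integral_equation m (lam : R) d u : Prop :=
  forall x, 0 <= x ->
    (stieltjes m).-integrable `]0, x] (fun y => ((x - y) * u y)%:E) /\
    u x = lam ^+ d * G m d x
          + lam * \int[stieltjes m]_(y in `]0, x]) ((x - y) * u y).

Definition rquot u (x : R) : R -> R := fun h => h^-1 * (u (x + h) - u x).

Definition rderiv u (x : R) : R := lim (rquot u x h @[h --> 0^'+]).

Definition string_equation m (lam : R) u : Prop :=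
  [/\ {within `[0, +oo[, continuous u},
      forall x, 0 < x -> cvg (rquot u x h @[h --> 0^'+]),
      forall a b, 0 < a -> a < b ->
        leb.-integrable `]a, b] (fun x => (rderiv u x)%:E) /\
        u b - u a = \int[leb]_(x in `]a, b]) rderiv u x &
      forall a b, 0 < a -> a < b ->
        rderiv u b - rderiv u a = lam * \int[stieltjes m]_(x in `]a, b]) u x].

(* The function subtracted from the right derivative of [u] is the right
   derivative of [\sum_(1 <= k < d.+1) lam ^+ k * G m k], because
   (G^1)^+ = tilde m and (G^(k+1))^+(x) = - \int_x^1 G^k dm. *)
Definition modified_neumann m (lam : R) d u : Prop :=
  u 0 = 1 /\
  rderiv u x - (lam * tilde m x
                - \sum_(1 <= k < d) lam ^+ k.+1 * oint m x 1 (G m k))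
    @[x --> 0^'+] --> (0 : R).

End strings.

(* Main.v *)
Require Import Defs.
From HB Require Import structures.
From mathcomp Require Import all_boot all_order all_algebra.
From mathcomp Require Import all_classical all_reals all_analysis.
From mathcomp Require Import measurable_realfun lra ring.
Set Implicit Arguments.
Unset Strict Implicit.
Unset Printing Implicit Defensive.
Import Order.TTheory GRing.Theory Num.Theory.
Import numFieldNormedType.Exports.
Local Open Scope classical_set_scope.
Local Open Scope ring_scope.

(* The condition [sindex m <= d] ensures that G^d is dm-integrable on every (0, T].
   For such functions f, Fubini turns [dots (dotm m f)] into the Volterra operator
   K f (x) = int_(0,x] (x - z) f(z) dm(z).  On functions bounded by
   C x e^(beta x) on (0, T], the operator K multiplies C by
   int_(0,T] min(z, 1/beta) dm(z), which tends to 0 as beta -> oo by dominated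
   convergence.  Taking this factor below 1/(2 lam) makes the Neumann series
   converge geometrically and any solution of w = lam K w vanish.

   For the boundary value problem, q = sum_(k<=d) lam^k (G^k)^+ is the slope of
   the head of the series, and u^+ - q = lam int_(0,x] w dm, where
   w = u - (1 + sum_(k<d) lam^k G^k): both sides have the same increments, and
   the modified Neumann condition says that both vanish at 0+. *)

(** * Integrals over half-open intervals *)

(** The difficulty sits at 0, where dm may have infinite mass while z dm(z) stays finite. A bounded
    function need not be dm-integrable there, but one that is O(x) is. For dm-integrable f one has
    |K f(x)| <= x int |f| dm, and this is the origin of the factor x in the weight. The starting
    function G^d need not be O(x) (for m = log, G^1 is x log x - x), so weighted bounds begin only
    after one application of K. The factor 1/(2 lam) makes lam K halve the weighted bound.

    The differential equation speaks only of intervals (a, b] with a > 0, so in the converse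
    direction the dm-integrability of w at 0 has to be extracted from the boundary condition: it
    keeps u^+ - q bounded near 0, hence u minus the head with d terms is O(x), and w differs from
    this by lam^d G^d. *)

Lemma itv_oc0_bigcup (R : realType) (T : R) :
  \bigcup_n `](n.+1%:R^-1 : R), T]%classic = `]0, T]%classic.
Proof.
apply/seteqP; split=> x /=.
  move=> [n _]; rewrite /= !in_itv/= => /andP[nx ->]; rewrite andbT.
  by rewrite (lt_trans _ nx).
rewrite in_itv/= => /andP[x0 xT].
exists (Num.bound x^-1) => //; rewrite /= in_itv/= xT andbT.
rewrite invf_plt ?posrE//.
apply: lt_le_trans (archi_boundP _) _; first by rewrite invr_ge0 ltW.
by rewrite ler_nat.
Qed.

Section half_open_intervals.
Context {R : realType} (mu : {measure set (measurableTypeR R) -> \bar R}).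
Implicit Types (f g : R -> R) (a b c x : R).

Lemma integrable_measurable_fun (D : set R) f :
  mu.-integrable D (EFin \o f) -> measurable_fun D f.
Proof. by move/(measurable_int mu)/measurable_EFinP. Qed.

Lemma integrable_subitv f a b a' b' : a <= a' -> b' <= b ->
  mu.-integrable `]a, b] (EFin \o f) -> mu.-integrable `]a', b'] (EFin \o f).
Proof.
move=> aa bb; apply: integrableS => //; apply: subset_itv; by rewrite bnd_simp.
Qed.

Lemma integrable_itvD f g a b :
  mu.-integrable `]a, b] (EFin \o f) -> mu.-integrable `]a, b] (EFin \o g) ->
  mu.-integrable `]a, b] (EFin \o (fun x => f x + g x)).
Proof. by move=> fi gi; apply: (integrableD _ fi gi). Qed.

Lemma integrable_itvB f g a b :
  mu.-integrable `]a, b] (EFin \o f) -> mu.-integrable `]a, b] (EFin \o g) ->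
  mu.-integrable `]a, b] (EFin \o (fun x => f x - g x)).
Proof. by move=> fi gi; apply: (integrableB _ fi gi). Qed.

Lemma integrable_itvZ f a b c : mu.-integrable `]a, b] (EFin \o f) ->
  mu.-integrable `]a, b] (EFin \o (fun x => c * f x)).
Proof. by move=> fi; apply: (integrableZl _ c fi). Qed.

Lemma integrable_itvN f a b : mu.-integrable `]a, b] (EFin \o f) ->
  mu.-integrable `]a, b] (EFin \o (fun x => - f x)).
Proof. by move=> fi; apply: (integrableN fi). Qed.

Lemma integrable_itv_sum (I : Type) (r : seq I) (F : I -> R -> R) a b :
  (forall i, mu.-integrable `]a, b] (EFin \o F i)) ->
  mu.-integrable `]a, b] (EFin \o (fun x => \sum_(i <- r) F i x)).
Proof.
move=> Fi; have -> : EFin \o (fun x => \sum_(i <- r) F i x) =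
  (fun x => (\sum_(i <- r) (F i x)%:E)%E).
  by apply/funext => x /=; rewrite sumEFin.
by apply: integrable_sum => // i _; exact: Fi.
Qed.

Lemma Rintegral_itv_sum (I : Type) (r : seq I) (F : I -> R -> R) a b :
  (forall i, mu.-integrable `]a, b] (EFin \o F i)) ->
  \int[mu]_(x in `]a, b]) (\sum_(i <- r) F i x) =
  \sum_(i <- r) \int[mu]_(x in `]a, b]) F i x.
Proof.
move=> Fi; elim: r => [|i r IH].
  rewrite big_nil; under eq_Rintegral do rewrite big_nil.
  by rewrite Rintegral_cst// mul0r.
rewrite big_cons -IH -RintegralD//; last exact: integrable_itv_sum.
by apply: eq_Rintegral => x _; rewrite big_cons.
Qed.

Lemma le_integrable_itv f g a b : measurable_fun `]a, b] f ->
  {in `]a, b], forall x, `|f x| <= g x} ->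
  mu.-integrable `]a, b] (EFin \o g) -> mu.-integrable `]a, b] (EFin \o f).
Proof.
move=> mf fg gi; apply: le_integrable gi => //.
  by move/measurable_EFinP : mf; exact.
by move=> x /= xab; rewrite lee_fin (le_trans (fg _ xab))// ler_norm.
Qed.

Lemma Rintegral_itv_cat f a b c : a <= b -> b <= c ->
  mu.-integrable `]a, c] (EFin \o f) ->
  \int[mu]_(x in `]a, c]) f x =
  \int[mu]_(x in `]a, b]) f x + \int[mu]_(x in `]b, c]) f x.
Proof.
move=> ab bc fi.
have E : [set` `]a, c]] = [set` `]a, b]] `|` [set` `]b, c]].
  by rewrite -itv_bndbnd_setU// bnd_simp.
rewrite E in fi *; rewrite Rintegral_setU//.
apply/disj_setPS => y [/=]; rewrite !in_itv/= => /andP[_ yx] /andP[].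
by rewrite ltNge yx.
Qed.

Lemma Rintegral_itv_geC f a b : b <= a -> \int[mu]_(x in `]a, b]) f x = 0.
Proof. by move=> ba; rewrite set_itv_ge ?Rintegral_set0// bnd_simp -leNgt. Qed.

(** The intervals []a, x]] decrease to the empty set as x decreases to [a], so a possible atom of
    [mu] at [a] is harmless. *)
Lemma Rintegral_oc_cvg0 f a b : a < b -> mu.-integrable `]a, b] (EFin \o f) ->
  \int[mu]_(z in `]a, x]) f z @[x --> a^'+] --> (0 : R).
Proof.
move=> ab fi.
have mf := integrable_measurable_fun fi.
suff H : \int[mu]_(z in `]a, b] `&` `]a, x]) f z @[x --> a^'+] --> (0 : R).
  apply: cvg_trans H; apply: near_eq_cvg; near=> x.
  congr Rintegral; apply/seteqP; split=> [y [_ //]|y /= yax]; split => //.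
  move: yax; rewrite /= !in_itv/= => /andP[-> yx]; rewrite (le_trans yx)//.
  by near: x; exact: nbhs_right_le.
(* Dominated convergence is a statement about sequences, so the one-sided limit is tested along
   sequences. *)
apply/cvg_at_rightP => u [au ucvg].
have mfn n : measurable_fun `]a, b] (f \_ `]a, u n]).
  apply/measurable_restrict => //.
  by apply: measurable_funS mf => //; exact: subIsetl.
have /= := @dominated_convergence _ _ _ mu `]a, b] _
  (fun n => EFin \o (f \_ `]a, u n])) (cst 0%E) (fun x => `|f x|%:E).
case=> //.
- by move=> n; apply/measurable_EFinP; exact: mfn.
- apply: aeW => x; rewrite /= in_itv/= => /andP[ax xb].
  apply: cvg_EFin; first by apply: nearW.
  apply: cvg_near_cst; near=> n; rewrite /= /patch; case: ifPn => //.
  move=> /set_mem/=; rewrite in_itv/= => /andP[_]; rewrite leNgt => /negP[].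
  by near: n; move/cvgr_lt : ucvg; exact.
- exact: integrable_norm.
- apply: aeW => x n _; rewrite /= lee_fin /patch; case: ifPn => //.
  by rewrite normr0.
move=> _ _; rewrite integral0 => H.
under eq_fun do rewrite Rintegral_mkcondr.
exact: (fine_cvg H).
Unshelve. all: by end_near. Qed.

Lemma le_Rintegral_itv_norm f a b x : x <= b -> mu.-integrable `]a, b] (EFin \o f) ->
  `|\int[mu]_(z in `]a, x]) f z| <= \int[mu]_(z in `]a, b]) `|f z|.
Proof.
move=> xb fi.
have [ax|xa] := leP a x; last first.
  rewrite Rintegral_itv_geC; last exact: ltW.
  by rewrite normr0; exact: Rintegral_ge0.
have fx : mu.-integrable `]a, x] (EFin \o f) by apply: integrable_subitv fi.
apply: (le_trans (le_normr_Rintegral _ fx)) => //.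
rewrite (@Rintegral_itv_cat _ a x b)//; last exact: integrable_norm.
by rewrite lerDl Rintegral_ge0.
Qed.

Lemma Rintegral_oc_cvgr f a x b : a <= x -> x < b ->
  mu.-integrable `]a, b] (EFin \o f) ->
  \int[mu]_(z in `]a, y]) f z @[y --> x^'+] --> \int[mu]_(z in `]a, x]) f z.
Proof.
move=> ax xb fi.
have fx : mu.-integrable `]x, b] (EFin \o f) by apply: integrable_subitv fi.
have H : \int[mu]_(z in `]a, x]) f z + \int[mu]_(z in `]x, y]) f z @[y --> x^'+] -->
    \int[mu]_(z in `]a, x]) f z + 0.
  by apply: cvgD; [exact: cvg_cst|exact: Rintegral_oc_cvg0 fx].
rewrite addr0 in H; apply: cvg_trans H; apply: near_eq_cvg; near=> y.
have xy : x <= y by near: y; exact: nbhs_right_ge.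
have yb : y <= b by near: y; exact: nbhs_right_le.
by rewrite -Rintegral_itv_cat//; exact: integrable_subitv fi.
Unshelve. all: by end_near. Qed.

(** The three points may come in any order: if [b] lies outside [[a, c]], one of the two given
    intervals already contains []a, c]]. *)
Lemma integrable_itv_cat f a b c :
  mu.-integrable `]a, b] (EFin \o f) -> mu.-integrable `]b, c] (EFin \o f) ->
  mu.-integrable `]a, c] (EFin \o f).
Proof.
move=> fab fbc.
have [ba|ab] := ltP b a; first by apply: integrable_subitv fbc => //; exact: ltW.
have [cb|bc] := ltP c b; first by apply: integrable_subitv fab => //; exact: ltW.
have -> : [set` `]a, c]] = [set` `]a, b]] `|` [set` `]b, c]].
  by rewrite -itv_bndbnd_setU// bnd_simp.
move: fab fbc => /integrableP[m1 i1] /integrableP[m2 i2].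
have mU : measurable_fun
    ([set` `]a, b]] `|` [set` `]b, c]] : set (measurableTypeR R)) (EFin \o f).
  by apply/measurable_funU.
apply/integrableP; split=> //.
rewrite integral_setU//; first by rewrite lte_add_pinfty.
  exact: measurableT_comp.
apply/disj_setPS => y [/=]; rewrite !in_itv/= => /andP[_ yx] /andP[].
by rewrite ltNge yx.
Qed.

End half_open_intervals.

(** * Lebesgue primitives *)

Section lebesgue_primitive.
Context {R : realType}.
Local Notation leb := (@lebesgue_measure R).
Implicit Types (f p u : R -> R) (a b x C : R).

Lemma lebesgue_oc a b : a <= b -> leb `]a, b] = (b - a)%:E.
Proof.
rewrite lebesgue_measure_itv/= lte_fin le_eqVlt => /predU1P[->|->//].
by rewrite ltxx subrr.
Qed.

Lemma integrable_lebesgue_cst a b C : leb.-integrable `]a, b] (EFin \o cst C).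
Proof.
have ab : (leb `]a, b] < +oo)%E.
  by rewrite lebesgue_measure_itv/=; case: ifPn; rewrite ltry.
apply: measurable_bounded_integrable => //.
exists `|C|; split => // M MC x _ /=; exact: ltW.
Qed.

Lemma le_Rintegral_lebesgue_cst p a b C : a <= b ->
  leb.-integrable `]a, b] (EFin \o p) -> {in `]a, b], forall y, `|p y| <= C} ->
  `|\int[leb]_(y in `]a, b]) p y| <= C * (b - a).
Proof.
move=> ab pi pC; apply: (le_trans (le_normr_Rintegral _ pi)) => //.
have -> : C * (b - a) = \int[leb]_(y in `]a, b]) C.
  by rewrite Rintegral_cst// [X in fine X]lebesgue_oc.
apply: le_Rintegral => //.
- exact: integrable_norm.
- exact: integrable_lebesgue_cst.
Qed.

(** One-sided fundamental theorem of calculus. Right continuity of the density is what is available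
    when dm has atoms. *)
Lemma rquot_primitive p u x b : x < b -> leb.-integrable `]x, b] (EFin \o p) ->
  p y @[y --> x^'+] --> p x ->
  (forall y, x < y -> u y - u x = \int[leb]_(z in `]x, y]) p z) ->
  rquot u x h @[h --> 0^'+] --> p x.
Proof.
move=> xb pi px ux; apply/cvgrPdist_le => /= e e0.
move/cvgrPdist_le : px => /(_ e e0) [d /= d0 pd].
near=> h.
have h0 : 0 < h by near: h; exact: nbhs_right_gt.
have hd : h < d by near: h; exact: nbhs_right_lt.
have hb : x + h <= b.
  by rewrite -lerBrDl; near: h; apply: nbhs_right_le; rewrite subr_gt0.
have pi' : leb.-integrable `]x, x + h] (EFin \o p) by exact: integrable_subitv pi.
rewrite /rquot ux ?ltrDl//.
(* [p x] is its own mean over []x, x + h]], so the error is the mean of [p x - p z]. *)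
have -> : p x - h^-1 * \int[leb]_(z in `]x, x + h]) p z =
   h^-1 * \int[leb]_(z in `]x, x + h]) (p x - p z).
  rewrite RintegralB//; last exact: integrable_lebesgue_cst.
  rewrite Rintegral_cst// [X in fine X]lebesgue_oc ?lerDl ?ltW//= addrAC subrr add0r.
  by rewrite mulrBr [p x * h]mulrC mulKf// gt_eqF.
rewrite normrM gtr0_norm ?invr_gt0// ler_pdivrMl// mulrC.
rewrite -{2}(addKr x h) [- x + _]addrC.
apply: le_Rintegral_lebesgue_cst.
- by rewrite lerDl ltW.
- by apply: integrable_itvB => //; exact: integrable_lebesgue_cst.
- move=> y; rewrite in_itv/= => /andP[xy yh]; apply: pd => //=.
  by rewrite ltr0_norm ?subr_lt0// opprB ltrBlDl (le_lt_trans yh)// ltrD2l.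
Unshelve. all: by end_near. Qed.

Lemma continuous_primitive p u :
  (forall b, leb.-integrable `]0, b] (EFin \o p)) ->
  (forall x, 0 <= x -> u x = u 0 + \int[leb]_(z in `]0, x]) p z) ->
  {within `[0, +oo[, continuous u}.
Proof.
move=> pi ux.

apply/subspace_continuousP => x /=; rewrite in_itv/= andbT => x0.
apply/cvgrPdist_lt => /= e e0.
have pi1 := pi (x + 1).
(* Absolute continuity of the integral is applied to the extension of [p] by 0 to the whole line;
   [x + 1] leaves room for all y within distance 1 of x. *)
have pr : leb.-integrable setT (EFin \o (p \_ `]0, x + 1])).
  by rewrite -restrict_EFin; apply: (integrable_mkcond _ _).1.
have [d [d0 dP]] := integral_normr_continuous pr e0.
near=> y; rewrite -![from_subspace _ _]/u.
have y0 : 0 <= y.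
  suff : `[0, +oo[%classic y by rewrite /= in_itv/= andbT.
  by near: y; exact: withinT.
have xyd : `|x - y| < d by near: y; apply: cvg_within; exact: nbhsx_ballx.
have xy1 : `|x - y| < 1 by near: y; apply: cvg_within; exact: nbhsx_ballx.
rewrite ux// [in X in _ - X]ux// opprD addrACA subrr add0r.
have key s t : 0 <= s -> s <= t -> t <= x + 1 -> t - s < d ->
  `|\int[leb]_(z in `]0, t]) p z - \int[leb]_(z in `]0, s]) p z| < e.
  move=> s0 st tx tsd.
  rewrite (@Rintegral_itv_cat _ _ _ 0 s t)//.
  rewrite addrAC subrr add0r.
  have st' : leb.-integrable `]s, t] (EFin \o p) by exact: integrable_subitv pi1.
  apply: (le_lt_trans (le_normr_Rintegral _ st')) => //.
  have std : (leb `]s, t] < d%:E)%E by rewrite lebesgue_oc.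
  apply: le_lt_trans (dP `]s, t]%classic (measurable_itv _) std).
  rewrite le_eqVlt; apply/orP; left; apply/eqP; apply: eq_Rintegral => z.
  rewrite inE/= in_itv/= => /andP[sz zt]; rewrite /patch ifT//.
  by rewrite inE/= in_itv/= (le_lt_trans s0 sz) (le_trans zt).
have [xy|/ltW yx] := leP x y.
  rewrite distrC; apply: key => //.
    by rewrite -lerBlDl ltW// (le_lt_trans (ler_norm _))// distrC.
  by rewrite (le_lt_trans (ler_norm _))// distrC.
apply: key => //; first by rewrite lerDl.
by rewrite (le_lt_trans (ler_norm _)).
Unshelve. all: by end_near. Qed.

End lebesgue_primitive.

(** * Fubini's theorem for tail integrals *)

Section fubini_tail.
Context {R : realType}
  (mu : {sigma_finite_measure set (measurableTypeR R) -> \bar R}).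
Local Notation leb := (@lebesgue_measure R).
Local Notation TR := (measurableTypeR R).
Implicit Types (f : R -> R) (T x y z : R).

(** On []y, T]] the factor z / y is at least 1, so z f(z) / y dominates f. *)
Lemma integrable_tail f T y : 0 < y -> measurable_fun `]0, T] f ->
  mu.-integrable `]0, T] (EFin \o (fun z => z * f z)) ->
  mu.-integrable `]y, T] (EFin \o f).
Proof.
move=> y0 mf zf.
have yT : [set` `]y, T]] `<=` [set` `]0, T]].
  by apply: subset_itvr; rewrite bnd_simp ltW.
apply: (@le_integrable_itv _ _ _ (fun z => `|y^-1 * (z * f z)|)).
- by apply: measurable_funS mf.
- move=> z; rewrite in_itv/= => /andP[yz _].
  rewrite 2!normrM mulrA ler_peMl// -normrM ger0_norm.
    by rewrite mulrC ler_pdivlMr// mul1r ltW.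
  by rewrite mulr_ge0 ?invr_ge0// ltW// (lt_trans y0).
- apply: (@integrable_norm _ _ _ mu _ (fun z => y^-1 * (z * f z))).
  by apply: integrable_itvZ; exact: integrableS zf.
Qed.

Let A := [set p : TR * TR | (0 < p.1) && (p.1 < p.2)].

Let mA : measurable A.
Proof.
have m1 : measurable_fun [set: TR * TR] (fun p : TR * TR => (p.1 : R)).
  exact: measurable_fst.
have m2 : measurable_fun [set: TR * TR] (fun p : TR * TR => (p.2 : R)).
  exact: measurable_snd.
have m0 : measurable_fun [set: TR * TR] (fun p : TR * TR => (0 : R)).
  exact: measurable_cst.
have : measurable_fun [set: TR * TR]
  (fun p : TR * TR => ((0 : R) < p.1) && ((p.1 : R) < p.2)).
  by apply: measurable_and; exact: measurable_fun_ltr.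
move=> /(_ measurableT [set true] I); rewrite setTI.
by congr measurable; apply/seteqP; split=> p /=.
Qed.

(** At fixed z, the section of [A] in the first variable is []0, z[], of length z: hence the factor
    z. The hypothesis bears on z f(z) because f itself may fail to be integrable at 0. *)
Lemma fubini_tail f T : measurable_fun `]0, T] f ->
  mu.-integrable `]0, T] (EFin \o (fun z => z * f z)) ->
  leb.-integrable `]0, T] (EFin \o (fun y => \int[mu]_(z in `]y, T]) f z)) /\
  \int[leb]_(y in `]0, T]) (\int[mu]_(z in `]y, T]) f z) =
  \int[mu]_(z in `]0, T]) (z * f z).
Proof.
move=> mf zf.
pose f' : R -> R := f \_ `]0, T].
have mf' : measurable_fun [set: TR] f'.
  by apply/(measurable_restrictT _ _).1.
pose F : TR * TR -> \bar R := fun p => (f' p.2 * \1_A p)%:E.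
have mF : measurable_fun [set: TR * TR] F.
  apply/measurable_EFinP; apply: measurable_funM; last exact: measurable_indic.
  exact: (measurableT_comp mf' measurable_snd).
have indA y z : \1_A (y, z) = \1_(`]0, z[%classic) y :> R.
  rewrite !indicE; suff -> : ((y, z) \in A) = (y \in `]0, z[%classic) by [].
  by apply/idP/idP; rewrite !inE.
have leb0z z : 0 < z -> leb `]0, z[ = z%:E.
  by move=> z0; rewrite lebesgue_measure_itv/= lte_fin z0 oppr0 adde0.
have f'0 z : z \notin `]0, T] -> f' z = 0.
  by move=> zT; rewrite /f' /patch ifF// mem_setE; exact/negbTE.
have f'E z : z \in `]0, T] -> f' z = f z.
  by move=> zT; rewrite /f' /patch ifT// mem_setE.
have GE z : (\int[leb]_y F (y, z))%E = ((fun z => z * f z) \_ `]0, T] z)%:E.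
  rewrite /F /=; under eq_integral do rewrite indA EFinM.
  rewrite integralZl//=; last exact: integrable_indic_itv.
  rewrite integral_indic// setIT /patch mem_setE; case: ifPn => zT.
    have z0 : 0 < z by move: zT; rewrite in_itv/= => /andP[].
    by rewrite f'E// [X in (_ * X)%E]leb0z// mulrC.
  by rewrite f'0// mul0e.
have GaE z : (\int[leb]_y `|F (y, z)|)%E = ((fun z => `|z * f z|) \_ `]0, T] z)%:E.
  rewrite /F /=; under eq_integral.
    move=> y _; rewrite indA normrM [X in _ * X]ger0_norm// EFinM; over.
  rewrite integralZl//=; last exact: integrable_indic_itv.
  rewrite integral_indic// setIT /patch mem_setE; case: ifPn => zT.
    have z0 : 0 < z by move: zT; rewrite in_itv/= => /andP[].
    by rewrite f'E// [X in (_ * X)%E]leb0z// normrM (gtr0_norm z0) mulrC.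
  by rewrite f'0// normr0 mul0e.
(* Tonelli in the order where the inner integral of |F| is explicit: it equals |z f(z)|. *)
have iF : (leb \x mu)%E.-integrable setT F.
  apply/integrable21ltyP => //; under eq_integral do rewrite GaE.
  have /integrableP[_] := zf; apply: le_lt_trans; rewrite [leRHS]integral_mkcond.
  rewrite le_eqVlt; apply/orP; left; apply/eqP.
  by apply: eq_integral => z _; rewrite /patch; case: ifP.
have FE y : fubini_F mu F y = ((fun y => \int[mu]_(z in `]y, T]) f z) \_ `]0, T] y)%:E.
  rewrite /fubini_F /F /patch mem_setE; case: ifPn => yT; last first.
    apply: integral0_eq => z _ /=; rewrite indA indicE.
    have [/set_mem/=|] := boolP (y \in _); last by rewrite mulr0.
    rewrite in_itv/= => /andP[y0 yz]; rewrite mulr1 f'0//.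
    apply: contra yT; rewrite !in_itv/= => /andP[_ zT].
    by rewrite y0 (le_trans _ zT)// ltW.
  move: yT; rewrite in_itv/= => /andP[y0 yT].
  rewrite fineK; last first.
    by apply: integrable_fin_num => //; exact: integrable_tail zf.
  rewrite [RHS]integral_mkcond; apply: eq_integral => z _ /=.
  rewrite restrict_EFin; congr EFin; rewrite indA indicE /f' /patch !mem_setE/=.
  rewrite !in_itv/= y0/=; have [yz|zy] := ltP y z; last by rewrite mulr0.
  by rewrite (lt_trans y0 yz)/= mulr1.
split.
  apply/(integrable_mkcond _ _).2 => //; rewrite restrict_EFin.
  have -> : EFin \o (fun y => \int[mu]_(z in `]y, T]) f z) \_ `]0, T] = fubini_F mu F.
    by apply/funext => y; rewrite FE.
  exact: integrable_fubini_F.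
rewrite [LHS]Rintegral_mkcond [RHS]Rintegral_mkcond /Rintegral; congr fine.
transitivity (\int[leb]_y fubini_F mu F y)%E.
  by apply: eq_integral => y _; rewrite FE.
rewrite integral12_prod_meas1// -integral21_prod_meas1//.
by apply: eq_integral => z _; rewrite /fubini_G GE.
Qed.

End fubini_tail.

(** * The functions G^k *)

Section string_functions.
Context {R : realType} (m : rc_increasing R) (hm : classM m).
Local Notation leb := (@lebesgue_measure R).
Local Notation mu := (stieltjes m).
Implicit Types (f p : R -> R) (a b c x y z T C : R) (k n d : nat).

Lemma integrable_stieltjes_bounded f a b C : 0 < a -> measurable_fun `]a, b] f ->
  {in `]a, b], forall x, `|f x| <= C} -> mu.-integrable `]a, b] (EFin \o f).
Proof.
move=> a0 mf fC.
have ab : (mu `]a, b] < +oo)%E.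
  have [ab|ba] := leP a b; first by rewrite stieltjes_itv ?ltry.
  by rewrite set_itv_ge ?measure0// bnd_simp -leNgt ltW.
apply: measurable_bounded_integrable => //.
exists C; split; first exact: num_real.
by move=> M /ltW CM x /= xab; rewrite (le_trans _ CM)// fC.
Qed.

(** Boundedness up to 0 makes z f(z) dm-integrable on []0, T]], as [fubini_tail] demands, even when
    f is not. *)
Definition locally_bounded f := forall T,
  measurable_fun `]0, T] f /\ exists C, {in `]0, T], forall x, `|f x| <= C}.

Lemma locally_bounded_cst c : locally_bounded (cst c).
Proof. by move=> T; split => //; exists `|c|. Qed.

Lemma locally_bounded_measurable f : locally_bounded f ->
  forall T, measurable_fun `]0, T] f.
Proof. by move=> + T => /(_ T)[]. Qed.

Lemma integrable_stieltjes_id T : mu.-integrable `]0, T] (EFin \o id).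
Proof.
have m1 a b : measurable_fun `]a, b] (@id R) by exact: measurable_id.
apply: (@integrable_itv_cat _ _ _ _ 1).
  apply/integrableP; split; first exact/measurable_EFinP.
  apply: le_lt_trans hm; rewrite le_eqVlt; apply/orP; left; apply/eqP.
  apply: eq_integral => z /set_mem/=; rewrite in_itv/= => /andP[z0 _].
  by rewrite ger0_norm// ltW.
apply: (@integrable_stieltjes_bounded _ _ _ T) => // x.
rewrite in_itv/= => /andP[x1 xT].
by rewrite ger0_norm// ltW// (lt_trans _ x1).
Qed.

Lemma locally_bounded_integrable_id f T : locally_bounded f ->
  mu.-integrable `]0, T] (EFin \o (fun z => z * f z)).
Proof.
move=> /(_ T)[mf [C fC]].
apply: (@le_integrable_itv _ _ _ (fun z => C * z)).
- by apply: measurable_funM => //; exact: measurable_id.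
- move=> z zT; rewrite normrM mulrC.
  have z0 : 0 < z by move: zT; rewrite in_itv/= => /andP[].
  by rewrite (gtr0_norm z0) ler_wpM2r ?fC// ltW.
- by apply: integrable_itvZ; exact: integrable_stieltjes_id.
Qed.

Lemma locally_bounded_integrable f a b : 0 < a -> locally_bounded f ->
  mu.-integrable `]a, b] (EFin \o f).
Proof.
move=> a0 fb; apply: integrable_tail => //; first exact: locally_bounded_measurable.
exact: locally_bounded_integrable_id.
Qed.

(** A common right end [T] beyond y and 1 absorbs the sign convention of [oint] and leaves, up to a
    constant, a tail integral to which [fubini_tail] applies. *)
Lemma ointE f y T : 0 < y -> y <= T -> 1 <= T -> locally_bounded f ->
  oint m y 1 f = \int[mu]_(z in `]y, T]) f z - \int[mu]_(z in `]1, T]) f z.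
Proof.
move=> y0 yT T1 fb; rewrite /oint; case: ifPn => [y1|].
  rewrite (@Rintegral_itv_cat _ _ _ y 1 T)// ?addrK//.
  exact: locally_bounded_integrable.
rewrite -ltNge => /ltW y1; rewrite (@Rintegral_itv_cat _ _ _ 1 y T)//.
  by rewrite opprD addrCA subrr addr0.
exact: locally_bounded_integrable.
Qed.

Lemma ointB f a b : 0 < a -> a <= b -> locally_bounded f ->
  oint m a 1 f - oint m b 1 f = \int[mu]_(z in `]a, b]) f z.
Proof.
move=> a0 ab fb; have b0 := lt_le_trans a0 ab.
have bM : b <= Num.max b 1 by rewrite le_max lexx.
have M1 : 1 <= Num.max b 1 by rewrite le_max lexx orbT.
rewrite (ointE a0 (le_trans ab bM) M1)// (ointE b0 bM M1)//.
rewrite opprB addrA subrK (@Rintegral_itv_cat _ _ _ a b)// ?addrK//.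
exact: locally_bounded_integrable.
Qed.

Lemma oint_integrable f T : locally_bounded f ->
  leb.-integrable `]0, T] (EFin \o (fun y => oint m y 1 f)).
Proof.
move=> fb; pose M := Num.max T 1.
have M1 : 1 <= M by rewrite le_max lexx orbT.
apply: (@integrable_subitv _ _ _ 0 M) => //; first by rewrite le_max lexx.
have [fi _] := @fubini_tail _ mu f M (locally_bounded_measurable fb (T:=M))
  (locally_bounded_integrable_id M fb).
apply: eq_integrable (integrable_itvB fi (integrable_lebesgue_cst _ _
  (\int[mu]_(z in `]1, M]) f z))) => //.
move=> y /set_mem/=; rewrite in_itv/= => /andP[y0 yM].
by rewrite (ointE y0 yM M1).
Qed.

Lemma oint_cvgr f x : 0 < x -> locally_bounded f ->
  oint m y 1 f @[y --> x^'+] --> oint m x 1 f.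
Proof.
move=> x0 fb.
have H : oint m x 1 f - \int[mu]_(z in `]x, y]) f z @[y --> x^'+] --> oint m x 1 f - 0.
  apply: cvgB; first exact: cvg_cst.
  apply: (@Rintegral_oc_cvg0 _ _ _ _ (x + 1)); first by rewrite ltrDl.
  exact: locally_bounded_integrable.
rewrite subr0 in H; apply: cvg_trans H; apply: near_eq_cvg; near=> y.
have xy : x <= y by near: y; exact: nbhs_right_ge.
by rewrite -(ointB x0 xy fb) subKr.
Unshelve. all: by end_near. Qed.

(** With [G m 0] equal to 1, the definition of G^1 becomes the case k = 0 of the recursion [GS], so
    inductions can start at 0. *)
Lemma tildeE y : 0 < y -> tilde m y = - oint m y 1 (G m 0).
Proof.
move=> y0; rewrite /tilde /oint /=; case: ifPn => [y1|].
  by rewrite Rintegral_cst// [X in fine X]stieltjes_itv//= mul1r opprB.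
rewrite -ltNge => y1.
by rewrite Rintegral_cst// [X in fine X]stieltjes_itv ?ltW//= mul1r opprK.
Qed.

Lemma GS k x : G m k.+1 x = - \int[leb]_(y in `]0, x]) oint m y 1 (G m k).
Proof.
case: k => [|//].
rewrite /= -[RHS]mulN1r -RintegralZl//; last exact/oint_integrable/locally_bounded_cst.
apply: eq_Rintegral => y /set_mem/=; rewrite in_itv/= => /andP[y0 _].
by rewrite tildeE// mulN1r.
Qed.

Lemma G0 k : G m k.+1 0 = 0.
Proof. by rewrite GS Rintegral_itv_geC// oppr0. Qed.

Lemma locally_bounded_primitive f p : (forall T, leb.-integrable `]0, T] (EFin \o p)) ->
  (forall x, 0 <= x -> f x = \int[leb]_(y in `]0, x]) p y) -> locally_bounded f.
Proof.
move=> pi fE T; split.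
  suff : {within `]0, T], continuous f}.
    by move/subspace_continuous_measurable_fun; apply.
  have f0 : f 0 = 0 by rewrite fE// Rintegral_itv_geC.
  have cf : {within `[0, +oo[, continuous f}.
    by apply: (continuous_primitive pi) => x x0; rewrite f0 add0r fE.
  by apply: continuous_subspaceW cf; apply: subset_itv; rewrite bnd_simp.
exists (\int[leb]_(y in `]0, T]) `|p y|) => x; rewrite in_itv/= => /andP[x0 xT].
by rewrite (fE _ (ltW x0)); exact: (le_Rintegral_itv_norm xT (pi T)).
Qed.

Lemma locally_bounded_G k : locally_bounded (G m k).
Proof.
elim: k => [|k IH]; first exact: locally_bounded_cst.
apply: (@locally_bounded_primitive _ (fun y => - oint m y 1 (G m k))).
  by move=> T; apply: integrable_itvN; exact: oint_integrable.
move=> x x0; rewrite GS -[LHS]mulN1r -RintegralZl//; last exact: oint_integrable.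
by apply: eq_Rintegral => y _; rewrite mulN1r.
Qed.

(** Identifies the integrand in [sindex] with |G^k|, so that finiteness of that integral is
    integrability of [G m k]. *)
Lemma G_sign k x : 0 <= x -> x <= 1 -> 0 <= (-1) ^+ k * G m k x.
Proof.
elim: k x => [|k IH] x x0 x1; first by rewrite expr0 mulr1.
rewrite GS exprS mulrN mulN1r mulNr opprK -RintegralZl//; last first.
  exact/oint_integrable/locally_bounded_G.
apply: Rintegral_ge0 => y /=; rewrite in_itv/= => /andP[y0 yx].
rewrite /oint ifT ?(le_trans yx)// -RintegralZl//; last first.
  by apply: locally_bounded_integrable => //; exact: locally_bounded_G.
apply: Rintegral_ge0 => z /=; rewrite in_itv/= => /andP[yz z1].
by apply: IH => //; rewrite ltW// (lt_trans y0).
Qed.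

End string_functions.

Local Arguments G : simpl never.

(** * Integrability of G^d from the index d(m) *)

Section sindex.
Context {R : realType} (m : rc_increasing R) (hm : classM m).
Local Notation leb := (@lebesgue_measure R).
Local Notation mu := (stieltjes m).
Implicit Types (f p : R -> R) (a b c x y z T C : R) (k n d : nat).

Lemma integrable_G_cat k T : mu.-integrable `]0, 1] (EFin \o G m k) ->
  mu.-integrable `]0, T] (EFin \o G m k).
Proof.
move=> G1; apply: (integrable_itv_cat G1).
exact/locally_bounded_integrable/locally_bounded_G.
Qed.

(** If G^k is dm-integrable, its integrals over (y, 1] are bounded by a constant C, so |G^(k+1)(x)|
    <= C x, and x is dm-integrable. Thus integrability passes on to all larger indices. *)
Lemma integrable_GS k : mu.-integrable `]0, 1] (EFin \o G m k) ->
  mu.-integrable `]0, 1] (EFin \o G m k.+1).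
Proof.
move=> Gk; pose C := \int[mu]_(z in `]0, 1]) `|G m k z|.
apply: (@le_integrable_itv _ _ (G m k.+1) (fun x => C * x)).
- by apply: locally_bounded_measurable; exact: locally_bounded_G.
- move=> x; rewrite in_itv/= => /andP[x0 x1].
  rewrite (GS hm) normrN -[X in _ * X]subr0.
  apply: le_Rintegral_lebesgue_cst; first exact: ltW.
    exact/oint_integrable/locally_bounded_G.
  move=> y; rewrite in_itv/= => /andP[y0 yx].
  rewrite /oint ifT ?(le_trans yx)//.
  have Gy : mu.-integrable `]y, 1] (EFin \o G m k).
    by apply: integrable_subitv Gk => //; exact: ltW.
  apply: (le_trans (le_normr_Rintegral _ Gy)) => //.
  have Gn : mu.-integrable `]0, 1] (EFin \o (fun z => `|G m k z|)).
    exact: (integrable_norm Gk).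
  rewrite /C (Rintegral_itv_cat (ltW y0) (le_trans yx x1) Gn).
  by rewrite lerDr Rintegral_ge0.
- by apply: integrable_itvZ; exact: integrable_stieltjes_id.
Qed.

Lemma integrable_G_le k d : (k <= d)%N -> mu.-integrable `]0, 1] (EFin \o G m k) ->
  mu.-integrable `]0, 1] (EFin \o G m d).
Proof.
move=> /subnKC <-; elim: (d - k)%N => [|n IH] Gk; first by rewrite addn0.
by rewrite addnS; apply: integrable_GS; exact: IH.
Qed.

Lemma bounded_below_of_lim : (-oo < lim ((m x)%:E @[x --> 0^'+]))%E ->
  exists c, forall x, 0 < x -> c <= m x.
Proof.
move=> mlim; apply: contrapT => /forallNP mc.
suff : lim ((m x)%:E @[x --> 0^'+]) = -oo%E by move=> E; rewrite E ltxx in mlim.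
apply/cvg_lim => //; apply/cvgeNyPle => A.
have /existsNP[x /not_implyP[x0 /negP]] := mc A; rewrite -ltNge => mxA.
near=> y; rewrite lee_fin; apply: le_trans (ltW mxA); apply/ltW/rc_lt.
  by near: y; exact: nbhs_right_gt.
by near: y; exact: nbhs_right_lt.
Unshelve. all: by end_near. Qed.

Lemma stieltjes_01_lty c : (forall x, 0 < x -> c <= m x) -> (mu `]0%R, 1%R] < +oo)%E.
Proof.
move=> mc; pose F n := `](n.+1%:R^-1 : R), 1]%classic.
have FE : \bigcup_n F n = `]0, 1]%classic by exact: itv_oc0_bigcup.
have Fmu : mu \o F @ \oo --> mu (\bigcup_n F n).
  apply: nondecreasing_cvg_mu.
  - by move=> n; exact: measurable_itv.
  - by rewrite FE; exact: measurable_itv.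
  - move=> i j ij; apply/subsetPset; apply: subset_itvr; rewrite bnd_simp.
    by rewrite lef_pV2 ?posrE// ler_nat ltnS.
rewrite -FE -(cvg_lim _ Fmu)//.
apply: (@le_lt_trans _ _ (m 1 - c)%:E); last by rewrite ltry.
apply: lime_le; first by apply/cvg_ex; exists (mu (\bigcup_n F n)).
apply: nearW => n /=; rewrite /F stieltjes_itv//; last by rewrite invf_le1// ler1n.
by rewrite lee_fin lerB// mc.
Qed.

Lemma integrable_G d : (maxe (sindex m) 1 <= d%:R%:E)%E ->
  mu.-integrable `]0, 1] (EFin \o G m d).
Proof.
rewrite ge_max => /andP[]; rewrite /sindex; case: ifPn => [/asboolP mlim _ _|_ sd d1].
  have [c /stieltjes_01_lty mu1] := bounded_below_of_lim mlim.
  (* Here d(m) = 0: dm has finite mass on (0, 1], so [G m 0], which is 1, is already integrable. *)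
  apply: (@integrable_G_le 0) => //.
  apply: (@measurable_bounded_integrable _ _ _ mu (cst 1) `]0%R, 1%R]) => //.
  by exists 1; split => // M M1 x _ /=; rewrite normr1 ltW.
(* Strict comparison with d + 1 produces an admissible k < d + 1, hence k <= d, without showing that
   the infimum is attained. *)
have : (ereal_inf [set k%:R%:E | k in [set k | (1 <= k)%N /\
    (\int[stieltjes m]_(x in `]0%R, 1%R]) ((-1) ^+ k * G m k x)%:E < +oo)%E]]
    < d.+1%:R%:E :> \bar R)%E.
  by apply: le_lt_trans sd _; rewrite lte_fin ltr_nat.
move=> /ereal_inf_lt[_ [k [k1 kfin] <-]]; rewrite lte_fin ltr_nat ltnS => kd.
apply: (integrable_G_le kd).
apply/integrableP; split.
  apply/measurable_EFinP; apply: locally_bounded_measurable; exact: locally_bounded_G.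
apply: le_lt_trans kfin; rewrite le_eqVlt; apply/orP; left; apply/eqP.
apply: eq_integral => x /set_mem/=; rewrite in_itv/= => /andP[x0 x1].
have := G_sign hm k (ltW x0) x1; move/ger0_norm => <-.
by rewrite normrM normrX normrN1 expr1n mul1r.
Qed.

End sindex.

(** * The Volterra operator *)

Section volterra.
Context {R : realType} (m : rc_increasing R) (hm : classM m).
Local Notation leb := (@lebesgue_measure R).
Local Notation mu := (stieltjes m).
Implicit Types (f p : R -> R) (a b c x y z T C : R) (k n d : nat).

Lemma integrable_id_mul f T : mu.-integrable `]0, T] (EFin \o f) ->
  mu.-integrable `]0, T] (EFin \o (fun z => z * f z)).
Proof.
move=> fi; apply: (@le_integrable_itv _ _ _ (fun z => `|T * f z|)).
- by apply: measurable_funM; [exact: measurable_id|exact: integrable_measurable_fun fi].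
- move=> z; rewrite in_itv/= => /andP[z0 zT]; rewrite !normrM ler_wpM2r//.
  by rewrite !ger0_norm// ltW// (lt_le_trans z0).
- apply: (@integrable_norm _ _ _ mu _ (fun z => T * f z)).
  exact: integrable_itvZ.
Qed.

Lemma integrable_kernel f x : mu.-integrable `]0, x] (EFin \o f) ->
  mu.-integrable `]0, x] (EFin \o (fun z => (x - z) * f z)).
Proof.
move=> fi; have -> : (fun z => (x - z) * f z) = (fun z => x * f z - z * f z).
  by apply/funext => z; rewrite mulrBl.
by apply: integrable_itvB; [exact: integrable_itvZ|exact: integrable_id_mul].
Qed.

(** Writes an integral from 0 as a total minus a tail, the form that [fubini_tail] can integrate in
    y. *)
Let dotm_tail f x y : 0 <= y -> y <= x -> mu.-integrable `]0, x] (EFin \o f) ->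
  dotm m f y = \int[mu]_(z in `]0, x]) f z - \int[mu]_(z in `]y, x]) f z.
Proof. by move=> y0 yx fi; rewrite /dotm (Rintegral_itv_cat y0 yx fi) addrK. Qed.

Lemma integrable_dotm f x : mu.-integrable `]0, x] (EFin \o f) ->
  leb.-integrable `]0, x] (EFin \o dotm m f).
Proof.
move=> fi.
have [ti _] := fubini_tail (integrable_measurable_fun fi) (integrable_id_mul fi).
apply: eq_integrable (integrable_itvB (integrable_lebesgue_cst _ _
  (\int[mu]_(z in `]0, x]) f z)) ti) => //.
move=> y /set_mem/=; rewrite in_itv/= => /andP[y0 yx].
by rewrite (dotm_tail (ltW y0) yx fi).
Qed.

Lemma dots_dotmE f x : 0 <= x -> mu.-integrable `]0, x] (EFin \o f) ->
  dots (dotm m f) x = \int[mu]_(z in `]0, x]) ((x - z) * f z).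
Proof.
move=> x0 fi; have zfi := integrable_id_mul fi.
have [ti tE] := fubini_tail (integrable_measurable_fun fi) zfi.
rewrite /dots (@eq_Rintegral _ _ _ leb _ (fun y =>
  \int[mu]_(z in `]0, x]) f z - \int[mu]_(z in `]y, x]) f z)); last first.
  move=> y /set_mem/=; rewrite in_itv/= => /andP[y0 yx].
  exact: (dotm_tail (ltW y0) yx fi).
rewrite [LHS]RintegralB; [|by []|exact: integrable_lebesgue_cst|exact: ti].
rewrite [X in X - _]Rintegral_cst; last by [].
rewrite [X in fine X](lebesgue_oc x0)/= subr0 tE.
rewrite [RHS](@eq_Rintegral _ _ _ mu _ (fun z => x * f z - z * f z)); last first.
  by move=> z _; rewrite mulrBl.
rewrite [RHS]RintegralB; [|by []|exact: integrable_itvZ|exact: zfi].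
by rewrite [X in _ = X - _]RintegralZl; [rewrite mulrC|by []|].
Qed.

Definition near0_integrable f := forall T, mu.-integrable `]0, T] (EFin \o f).

(** A bound C x near 0 suffices because x is dm-integrable there; away from 0, local boundedness
    does. *)
Lemma near0_integrable_bound f a C : 0 < a -> locally_bounded f ->
  {in `]0, a], forall x, `|f x| <= C * x} -> near0_integrable f.
Proof.
move=> a0 fb fC T; apply: (@integrable_itv_cat _ _ _ _ a); last first.
  exact: locally_bounded_integrable.
apply: (@le_integrable_itv _ _ _ (fun z => C * z)) => //.
  exact: locally_bounded_measurable.
by apply: integrable_itvZ; exact: integrable_stieltjes_id.
Qed.

(** One application of the operator turns mere dm-integrability into a bound proportional to x. *)
Lemma le_dots_dotm f x T : 0 <= x -> x <= T -> mu.-integrable `]0, T] (EFin \o f) ->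
  `|dots (dotm m f) x| <= \int[mu]_(z in `]0, T]) `|f z| * x.
Proof.
move=> x0 xT fi; rewrite -[X in _ * X]subr0.
have fx : mu.-integrable `]0, x] (EFin \o f) by exact: integrable_subitv fi.
apply: le_Rintegral_lebesgue_cst => //; first exact: integrable_dotm.
move=> y; rewrite in_itv/= => /andP[y0 yx].
by apply: le_Rintegral_itv_norm => //; exact: le_trans xT.
Qed.

Lemma locally_bounded_dots_dotm f : near0_integrable f ->
  locally_bounded (dots (dotm m f)).
Proof.
move=> fi; apply: (@locally_bounded_primitive _ _ (dotm m f)) => // T.
exact: integrable_dotm.
Qed.

Lemma near0_integrable_dots_dotm f : near0_integrable f ->
  near0_integrable (dots (dotm m f)).
Proof.
move=> fi; apply: (@near0_integrable_bound _ 1) => //.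
  exact: locally_bounded_dots_dotm.
by move=> x; rewrite in_itv/= => /andP[x0 x1]; apply: (le_dots_dotm (ltW x0) x1).
Qed.

Lemma truncation_small T e : 0 < e ->
  exists n, \int[mu]_(z in `]0, T]) Num.min z (n.+1%:R^-1) <= e.
Proof.
move=> e0.
have mid : measurable_fun `]0, T] (@id R) by exact: measurable_id.
have mmin n : measurable_fun `]0, T] (fun z : R => Num.min z (n.+1%:R^-1)).
  by apply: measurable_minr => //; exact: measurable_cst.
have /= := @dominated_convergence _ _ _ mu `]0, T] _
  (fun n => EFin \o (fun z : R => Num.min z (n.+1%:R^-1))) (cst 0%E) (EFin \o id).
case=> //.
- by move=> n; apply/measurable_EFinP; exact: mmin.
- apply: aeW => z; rewrite /= in_itv/= => /andP[z0 zT].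
  apply: cvg_EFin; first by apply: nearW.
  apply: (@squeeze_cvgr _ _ _ _ (cst 0) (@harmonic R)).
  + apply: nearW => n /=; rewrite le_min ge_min lexx orbT andbT.
    by rewrite ltW//= invr_ge0.
  + exact: cvg_cst.
  + exact: cvg_harmonic.
- exact: integrable_stieltjes_id.
- apply: aeW => z n; rewrite /= in_itv/= => /andP[z0 zT]; rewrite lee_fin.
  rewrite ger0_norm; first by rewrite ge_min lexx.
  by rewrite le_min ltW//= invr_ge0.
move=> _ _; rewrite integral0.
move=> /fine_cvg /cvgrPdist_le /(_ e e0)[N _ /(_ N (leqnn N))] H.
exists N; apply: le_trans H; rewrite sub0r normrN; exact: ler_norm.
Qed.

(* The weight e^(beta x) makes the Volterra operator contracting even when dm
   has atoms. *)
Lemma kernel_weight (beta x z : R) : 0 < beta -> 0 < z -> z <= x ->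
  (x - z) * (z * expR (beta * z)) <= x * expR (beta * x) * Num.min z beta^-1.
Proof.
move=> b0 z0 zx; have x0 := lt_le_trans z0 zx.
have xz0 : 0 <= x - z by rewrite subr_ge0.
(* The inequality 1 + t <= e^t with t = beta (x - z) serves both cases of the minimum: E >= 1
   together with x - z <= x when it is z, and E >= beta (x - z) together with z <= x when it is
   1/beta. *)
have [E E0] : {E | expR (beta * x) = expR (beta * z) * E & 1 + beta * (x - z) <= E}.
  exists (expR (beta * (x - z))); last exact: expR_ge1Dx.
  by rewrite -expRD -mulrDr addrC subrK.
rewrite {}E0 => E1; set e := expR (beta * z); have e0 : 0 < e := expR_gt0 _.
have -> : (x - z) * (z * e) = e * ((x - z) * z) by ring.
have -> t : x * (e * E) * t = e * (x * E * t) by ring.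
have bxz0 : 0 <= beta * (x - z) by rewrite mulr_ge0// ltW.
rewrite ler_pM2l// minEle; case: ifP => _.
  rewrite ler_pM2r//; apply: (@le_trans _ _ x); first by rewrite lerBlDr lerDl ltW.
  by apply: ler_peMr; [exact: ltW|lra].
rewrite ler_pdivlMr// mulrAC [leRHS]mulrC; apply: ler_pM => //; [|exact: ltW|].
  by rewrite mulr_ge0// ltW.
by rewrite mulrC; lra.
Qed.

(** The weight is fixed before [f] and [C], so the same [beta] serves at every iteration. *)
Lemma dots_dotm_contract T theta : 0 < theta -> exists2 beta, 0 < beta &
  forall f C, mu.-integrable `]0, T] (EFin \o f) ->
    (forall z, 0 < z -> z <= T -> `|f z| <= C * (z * expR (beta * z))) ->
    forall x, 0 < x -> x <= T ->
      `|dots (dotm m f) x| <= C * theta * (x * expR (beta * x)).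
Proof.
move=> th0; have [n nth] := truncation_small T th0.
exists n.+1%:R => //; set beta : R := n.+1%:R; have b0 : 0 < beta by rewrite ltr0n.
move=> f C fi fC x x0 xT.
have C0 : 0 <= C.
  have := le_trans (normr_ge0 _) (fC x x0 xT).
  by rewrite pmulr_lge0// mulr_gt0// expR_gt0.
have fx : mu.-integrable `]0, x] (EFin \o f) by exact: integrable_subitv fi.
have mi y : mu.-integrable `]0, y] (EFin \o (fun z => Num.min z beta^-1)).
  apply: (@le_integrable_itv _ _ _ id).
  - by apply: measurable_minr; [exact: measurable_id|exact: measurable_cst].
  - move=> z; rewrite in_itv/= => /andP[z0 _].
    rewrite ger0_norm; first by rewrite ge_min lexx.
    by rewrite le_min ltW//= invr_ge0 ltW.
  - exact: integrable_stieltjes_id.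
rewrite (dots_dotmE (ltW x0) fx).
have ki := integrable_kernel fx.
apply: (le_trans (le_normr_Rintegral _ ki)) => //.
apply: (@le_trans _ _ (\int[mu]_(z in `]0, x])
    (C * (x * expR (beta * x)) * Num.min z beta^-1))).
  apply: le_Rintegral => //.
  - exact: (integrable_norm ki).
  - exact: integrable_itvZ.
  - move=> z /=; rewrite in_itv/= => /andP[z0 zx].
    rewrite normrM ger0_norm ?subr_ge0//.
    apply: (@le_trans _ _ ((x - z) * (C * (z * expR (beta * z))))).
      by apply: ler_wpM2l; [rewrite subr_ge0|apply: fC => //; exact: le_trans xT].
    rewrite mulrCA -mulrA; apply: ler_wpM2l => //.
    exact: kernel_weight.
rewrite RintegralZl// mulrAC; apply: ler_wpM2r.
  by rewrite mulr_ge0 ?expR_ge0// ltW.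
apply: ler_wpM2l => //; apply: le_trans nth.
rewrite (Rintegral_itv_cat (ltW x0) xT (mi T)) lerDl.
apply: Rintegral_ge0 => z /=; rewrite in_itv/= => /andP[xz _].
by rewrite le_min invr_ge0 (ltW b0) andbT ltW// (lt_trans x0).
Qed.

End volterra.

(** * The Neumann series *)

Lemma geometric_tail (R : realType) (a : nat -> R) (A : R) :
  (forall k, `|a k.+1| <= A / 2 ^+ k) ->
  \sum_(1 <= k < n) a k @[n --> \oo] --> limn (fun n => \sum_(1 <= k < n) a k) /\
  forall n, `|limn (fun n => \sum_(1 <= k < n) a k) - \sum_(1 <= k < n.+1) a k|
            <= 2 * A / 2 ^+ n.
Proof.
move=> aA; have A0 : 0 <= A.
  by have := le_trans (normr_ge0 _) (aA 0%N); rewrite expr0 divr1.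
have p2 n : 0 < (2 : R) ^+ n by rewrite exprn_gt0.
have cv : cvgn (fun n => \sum_(1 <= k < n) a k).
  suff : cvgn (series (fun k => a k.+1)).
    move=> /cvg_ex[l sl]; apply/cvg_ex; exists l; rewrite -cvg_shiftS.
    apply: cvg_trans sl; apply: near_eq_cvg; apply: nearW => n.
    by rewrite /series /= big_add1.
  apply: normed_cvg; apply: (@series_le_cvg _ _ (geometric A 2^-1)).
  - by move=> n; exact: normr_ge0.
  - by move=> n; apply: mulr_ge0 => //; apply: exprn_ge0; rewrite invr_ge0.
  - by move=> n; apply: (le_trans (aA n)); rewrite /geometric /= exprVn.
  - by apply: is_cvg_geometric_series; rewrite ger0_norm// invf_lt1// ltr1n.
split => // n.
(* The bound is the exact sum of the geometric terms from n to n + N - 1; keeping the subtracted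
   term lets the induction telescope. *)
have key N : `|\sum_(1 <= k < (n + N).+1) a k - \sum_(1 <= k < n.+1) a k|
    <= 2 * A / 2 ^+ n - 2 * A / 2 ^+ (n + N).
  elim: N => [|N IH]; first by rewrite addn0 !subrr normr0.
  rewrite addnS big_nat_recr//= addrAC (le_trans (ler_normD _ _))//.
  apply: (le_trans (lerD IH (aA _))).
  rewrite exprS invfM.
  have -> : 2 * A * (2^-1 * (2 ^+ (n + N))^-1) = A / 2 ^+ (n + N).
    by rewrite mulrA [2 * A]mulrC mulfK.
  by rewrite -[2 * A / 2 ^+ (n + N)]mulrA mulr_natl mulr2n; lra.
have cvn : `|\sum_(1 <= k < N) a k - \sum_(1 <= k < n.+1) a k| @[N --> \oo] -->
    `|limn (fun n => \sum_(1 <= k < n) a k) - \sum_(1 <= k < n.+1) a k|.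
  by apply: cvg_norm; apply: cvgB => //; exact: cvg_cst.
rewrite -(cvg_lim _ cvn)//; apply: limr_le; first by apply/cvg_ex; eexists; exact: cvn.
near=> N.
have nN : (n < N)%N by near: N; exact: nbhs_infty_gt.
rewrite -(subnKC nN) addSn (le_trans (key _))// lerBlDr lerDl.
by rewrite divr_ge0// ?mulr_ge0// ltW.
Unshelve. all: by end_near. Qed.

Section neumann_series.
Context {R : realType} (m : rc_increasing R) (hm : classM m).
Local Notation leb := (@lebesgue_measure R).
Local Notation mu := (stieltjes m).
Implicit Types (f g : R -> R) (a b c x y z T C : R) (k n d : nat).

Lemma dots0 f : dots f 0 = 0.
Proof. by rewrite /dots Rintegral_itv_geC. Qed.

Lemma dots_dotmD f g x : near0_integrable m f -> near0_integrable m g -> 0 <= x ->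
  dots (dotm m (fun y => f y + g y)) x = dots (dotm m f) x + dots (dotm m g) x.
Proof.
move=> fi gi x0; rewrite /dots -RintegralD//; [|exact: integrable_dotm..].
by apply: eq_Rintegral => y _; rewrite /dotm RintegralD.
Qed.

Lemma dots_dotmZ f c x : near0_integrable m f -> 0 <= x ->
  dots (dotm m (fun y => c * f y)) x = c * dots (dotm m f) x.
Proof.
move=> fi x0; rewrite /dots -RintegralZl//; last exact: integrable_dotm.
by apply: eq_Rintegral => y _; rewrite /dotm RintegralZl.
Qed.

Lemma eq_dots_dotm f g x : (forall y, 0 < y -> f y = g y) ->
  dots (dotm m f) x = dots (dotm m g) x.
Proof.
move=> fg; apply: eq_Rintegral => y _; apply: eq_Rintegral => z /set_mem/=.
by rewrite in_itv/= => /andP[z0 _]; exact: fg.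
Qed.

Lemma near0_integrableD f g : near0_integrable m f -> near0_integrable m g ->
  near0_integrable m (fun y => f y + g y).
Proof. by move=> fi gi T; exact: integrable_itvD. Qed.

Lemma near0_integrableZ f c : near0_integrable m f ->
  near0_integrable m (fun y => c * f y).
Proof. by move=> fi T; exact: integrable_itvZ. Qed.

Variables (lam : R) (d : nat).
Hypotheses (lam0 : 0 < lam) (Gd : near0_integrable m (G m d)).

Local Notation h k := (iter k (dots \o dotm m) (G m d)).

Lemma near0_integrable_iter k : near0_integrable m (h k).
Proof. by elim: k => // k IH; exact: near0_integrable_dots_dotm. Qed.

Lemma phi_termS k x : 0 <= x ->
  phi_term m lam d k.+1 x = lam * dots (dotm m (phi_term m lam d k)) x.
Proof.
move=> x0; rewrite /phi_term dots_dotmZ//; last exact: near0_integrable_iter.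
by rewrite addnS exprS mulrA.
Qed.

Lemma near0_integrable_phi_term k : near0_integrable m (phi_term m lam d k).
Proof. by apply: near0_integrableZ; exact: near0_integrable_iter. Qed.

(** Used twice: for the terms of the series it yields convergence, and for a constant sequence, the
    difference of two solutions, it yields uniqueness. The bound starts at [w 1], since [w 0] is
    only known to be dm-integrable. *)
Lemma volterra_iter_decay (w : nat -> R -> R) T :
  (forall k, near0_integrable m (w k)) ->
  (forall k x, 0 < x -> x <= T -> w k.+1 x = lam * dots (dotm m (w k)) x) ->
  exists2 A, 0 <= A & forall k x, 0 < x -> x <= T -> `|w k.+1 x| <= A / 2 ^+ k * x.
Proof.
move=> wi wS.
have th0 : 0 < (2 * lam)^-1 by rewrite invr_gt0 mulr_gt0.
have [beta b0 contr] := dots_dotm_contract hm T th0.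
pose C := lam * \int[mu]_(z in `]0, T]) `|w 0%N z|.
have C0 : 0 <= C by rewrite mulr_ge0 ?(ltW lam0)// Rintegral_ge0.
have key k x : 0 < x -> x <= T -> `|w k.+1 x| <= C / 2 ^+ k * (x * expR (beta * x)).
  elim: k x => [|k IH] x x0 xT.
    rewrite wS// normrM (gtr0_norm lam0) expr0 divr1 /C -mulrA.
    apply: ler_wpM2l; first exact: ltW.
    apply: (le_trans (le_dots_dotm (ltW x0) xT (wi 0%N T))).
    apply: ler_wpM2l; first exact: Rintegral_ge0.
    by apply: ler_peMr; rewrite ?(ltW x0)// -expR0 ler_expR mulr_ge0// ltW.
  rewrite wS// normrM (gtr0_norm lam0).
  apply: (le_trans (ler_wpM2l (ltW lam0) (contr _ _ (wi k.+1 T) IH x x0 xT))).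
  rewrite exprS 2!invfM le_eqVlt; apply/orP; left; apply/eqP.
  have := lt0r_neq0 lam0; move: (2 ^+ k)^-1 => q l0; field.
  by rewrite l0.
(* The exponential has done its work in the induction; on []0, T]] it is replaced by its largest
   value. *)
exists (C * expR (beta * T)); first by rewrite mulr_ge0// expR_ge0.
move=> k x x0 xT; apply: (le_trans (key k x x0 xT)).
have -> : C / 2 ^+ k * (x * expR (beta * x)) = C / 2 ^+ k * x * expR (beta * x) by ring.
have -> : C * expR (beta * T) / 2 ^+ k * x = C / 2 ^+ k * x * expR (beta * T) by ring.
apply: ler_wpM2l; last by rewrite ler_expR ler_pM2l.
by apply: mulr_ge0; [apply: divr_ge0 => //; exact: exprn_ge0|exact: ltW].
Qed.

Definition phi_series x : R := limn (fun n => \sum_(1 <= k < n) phi_term m lam d k x).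

(** The factor x in the tail bound has two uses: bounded by [T] it gives uniform convergence, and
    being dm-integrable it lets the operator act on the remainder. *)
Lemma phi_series_tail T : exists2 A, 0 <= A & forall x, 0 <= x -> x <= T ->
  \sum_(1 <= k < n) phi_term m lam d k x @[n --> \oo] --> phi_series x /\
  forall n, `|phi_series x - \sum_(1 <= k < n.+1) phi_term m lam d k x|
            <= A / 2 ^+ n * x.
Proof.
have [||A A0 AP] := @volterra_iter_decay (phi_term m lam d) T.
- by move=> k; exact: near0_integrable_phi_term.
- by move=> k x x0 _; rewrite phi_termS// ltW.
exists (2 * A); first exact: mulr_ge0.
move=> x x0 xT.
have [|c tail] := @geometric_tail _ (fun k => phi_term m lam d k x) (A * x).
  move=> k; move: x0; rewrite le_eqVlt => /predU1P[<-|x0].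
    by rewrite mulr0 mul0r phi_termS// dots0 mulr0 normr0.
  by rewrite mulrAC; exact: AP.
split => // n; rewrite -[2 * A / 2 ^+ n * x]mulrAC -[2 * A * x]mulrA; exact: tail.
Qed.

Lemma cvg_uniform_phi (K : set R) : compact K -> K `<=` `[0, +oo[ ->
  {uniform K,
    (fun (n : nat) (x : R) =>
       phi_head m lam d x + \sum_(1 <= k < n) phi_term m lam d k x) @ \oo
    --> phi m lam d}.
Proof.
move=> /compact_bounded[M [Mreal MK]] K0.
pose T := `|M| + 1.
have KT x : K x -> 0 <= x /\ x <= T.
  move=> Kx; split; first by have := K0 _ Kx; rewrite /= in_itv/= andbT.
  apply: le_trans (ler_norm _) _; apply: (MK T) => //.
  by rewrite /T (le_lt_trans (ler_norm _))// ltrDl.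
have [A A0 AP] := phi_series_tail T.
have T0 : 0 <= T by rewrite addr_ge0.
move=> P /uniform_nbhs[E [entE EP]].
move: entE; rewrite -entourage_ballE => -[e /= e0 eE].
have : A * T * 2^-1 ^+ n @[n --> \oo] --> (0 : R).
  by apply: (@cvg_geometric _ (A * T)); rewrite ger0_norm// invf_lt1// ltr1n.
move=> /cvgrPdist_lt /(_ e e0)[N _ NP].
(* The partial sum over k < n has n - 1 terms, so the tail bound is used at n - 1; hence the shift
   of [N]. *)
exists N.+1 => //= n /= Nn; apply: EP => x /= Kx; apply: eE => /=.
have [x0 xT] := KT _ Kx; have [_ tail] := AP x x0 xT.
rewrite /ball/= /phi opprD addrACA subrr add0r.
case: n Nn => // n Nn; apply: (le_lt_trans (tail n)).
have := NP n Nn; rewrite /= sub0r normrN; apply: le_lt_trans.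
rewrite (le_trans _ (ler_norm _))// exprVn mulrAC.
by apply: ler_wpM2r; [rewrite invr_ge0 exprn_ge0|exact: ler_wpM2l].
Qed.

Lemma locally_bounded_phi_term k : locally_bounded (phi_term m lam d k).
Proof.
have hb : locally_bounded (h k).
  case: k => [|k]; first exact: locally_bounded_G.
  by apply: locally_bounded_dots_dotm => //; exact: near0_integrable_iter.
move=> T; have [mf [C fC]] := hb T; split.
  by apply: measurable_funM => //; exact: measurable_cst.
exists (`|lam ^+ (d + k)| * C) => x xT; rewrite normrM; apply: ler_wpM2l => //.
exact: fC.
Qed.

Lemma near0_integrable_phi_series : near0_integrable m phi_series.
Proof.
have [A1 _ AP1] := phi_series_tail 1.
apply: (@near0_integrable_bound _ _ hm _ 1 A1) => //; last first.
  move=> x; rewrite in_itv/= => /andP[x0 x1].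
  (* At n = 0 the partial sum is empty, and the tail bound reads |phi_series x| <= A1 x. *)
  have [_ /(_ 0%N)] := AP1 x (ltW x0) x1.
  by rewrite big_geq// subr0 expr0 divr1.
move=> T; have [A A0 AP] := phi_series_tail T; split.
  apply: (@measurable_fun_cvg _ _ _ _
    (fun n x => \sum_(1 <= k < n) phi_term m lam d k x)).
    move=> n; apply: measurable_sum => k.
    by have := locally_bounded_measurable (locally_bounded_phi_term k); exact.
  by move=> x /=; rewrite in_itv/= => /andP[x0 xT]; have [] := AP x (ltW x0) xT.
exists (A * T) => x; rewrite in_itv/= => /andP[x0 xT].
have [_ /(_ 0%N)] := AP x (ltW x0) xT.
rewrite big_geq// subr0 expr0 divr1 => /le_trans; apply.
exact: ler_wpM2l.
Qed.

End neumann_series.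

(** * Existence and uniqueness for the integral equation *)

Section integral_equation.
Context {R : realType} (m : rc_increasing R) (hm : classM m).
Local Notation leb := (@lebesgue_measure R).
Local Notation mu := (stieltjes m).
Implicit Types (f g u v : R -> R) (a b c x y z T C : R) (k n : nat).

Lemma near0_integrable_sum (I : Type) (r : seq I) (F : I -> R -> R) :
  (forall i, near0_integrable m (F i)) ->
  near0_integrable m (fun y => \sum_(i <- r) F i y).
Proof. by move=> Fi T; apply: integrable_itv_sum => i; exact: Fi. Qed.

Lemma dots_dotm_sum (I : Type) (r : seq I) (F : I -> R -> R) x :
  (forall i, near0_integrable m (F i)) -> 0 <= x ->
  dots (dotm m (fun y => \sum_(i <- r) F i y)) x =
  \sum_(i <- r) dots (dotm m (F i)) x.
Proof.
move=> Fi x0; elim: r => [|i r IH].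
  rewrite big_nil /dots (@eq_Rintegral _ _ _ leb _ (cst 0)).
    by rewrite Rintegral_cst// mul0r.
  move=> y _; rewrite /dotm (@eq_Rintegral _ _ _ mu _ (cst 0)).
    by rewrite Rintegral_cst// mul0r.
  by move=> z _; rewrite big_nil.
rewrite big_cons -IH -(dots_dotmD (Fi i) (near0_integrable_sum r Fi) x0).
by apply: eq_dots_dotm => y _; rewrite big_cons.
Qed.

Lemma near0_integrableB f g : near0_integrable m f -> near0_integrable m g ->
  near0_integrable m (fun y => f y - g y).
Proof. by move=> fi gi T; exact: integrable_itvB. Qed.

Lemma dots_dotmB f g x : near0_integrable m f -> near0_integrable m g -> 0 <= x ->
  dots (dotm m (fun y => f y - g y)) x = dots (dotm m f) x - dots (dotm m g) x.
Proof.
move=> fi gi x0; rewrite -[- dots _ _]mulN1r -(dots_dotmZ (-1) gi x0).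
rewrite -(dots_dotmD fi (near0_integrableZ (-1) gi) x0).
by apply: eq_dots_dotm => y _; rewrite mulN1r.
Qed.

Variables (lam : R) (d : nat).
Hypotheses (lam0 : 0 < lam) (Gd : near0_integrable m (G m d)).

(** The equation gives integrability of (x - y) u(y) only. Subtracting the kernels at x + 1 and at
    some x >= T leaves u itself on []0, T]]. *)
Lemma integral_equationP u : integral_equation m lam d u <->
  near0_integrable m u /\
  forall x, 0 <= x -> u x = lam ^+ d * G m d x + lam * dots (dotm m u) x.
Proof.
split=> [ieq|[ui ueq] x x0]; last first.
  split; last by rewrite -dots_dotmE// ueq.
  exact: (integrable_kernel (ui x)).
have ui : near0_integrable m u.
  move=> T; pose x := `|T| + 1.
  have x0 : 0 <= x by rewrite addr_ge0.
  have [i1 _] := ieq _ x0.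
  have [|i2 _] := ieq (x + 1); first by rewrite addr_ge0.
  have Tx : T <= x by rewrite (le_trans (ler_norm _))// lerDl.
  have j1 : mu.-integrable `]0, T] (EFin \o (fun y => (x - y) * u y)).
    exact: integrable_subitv i1.
  have j2 : mu.-integrable `]0, T] (EFin \o (fun y => (x + 1 - y) * u y)).
    by apply: integrable_subitv i2 => //; rewrite (le_trans Tx)// lerDl.
  apply: eq_integrable (integrable_itvB j2 j1) => // y _ /=.
  by congr EFin; ring.
split => // x x0; have [_ ->] := ieq x x0.
by rewrite dots_dotmE.
Qed.

(** The difference w of two solutions satisfies w = lam K w, so the constant sequence w obeys the
    recursion of [volterra_iter_decay], and |w(x)| <= A x / 2^n for every n. *)
Lemma integral_equation_unique u v : integral_equation m lam d u ->
  integral_equation m lam d v -> forall x, 0 <= x -> v x = u x.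
Proof.
move=> /integral_equationP[ui ueq] /integral_equationP[vi veq] x.
rewrite le_eqVlt => /predU1P[<-|x0].
  by rewrite (ueq 0 (lexx 0)) (veq 0 (lexx 0)) !dots0.
have wi := near0_integrableB vi ui.
have [||A A0 AP] := @volterra_iter_decay _ _ hm _ lam0 (fun=> fun y => v y - u y) x.
- by [].
- move=> _ y /ltW y0 _.
  by rewrite (dots_dotmB vi ui y0) (ueq y y0) (veq y y0); ring.
apply/eqP; rewrite -subr_eq0 -normr_le0.
have cA : A * x * 2^-1 ^+ n @[n --> \oo] --> (0 : R).
  by apply: (@cvg_geometric _ (A * x)); rewrite ger0_norm// invf_lt1// ltr1n.
rewrite -(cvg_lim _ cA)//; apply: limr_ge; first by apply/cvg_ex; eexists; exact: cA.
apply: nearW => n; apply: (le_trans (AP n x x0 (lexx _))).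
by rewrite exprVn mulrAC.
Qed.

(** The operator is applied to a finite partial sum, where it shifts the terms by one, and to a
    remainder [e n] whose image tends to 0. The function lam^d G^d is the term of index 0. *)
Lemma phi_series_fixpoint x : 0 <= x ->
  phi_series m lam d x =
  lam * dots (dotm m (fun y => lam ^+ d * G m d y + phi_series m lam d y)) x.
Proof.
move=> x0; set S := phi_series m lam d; set t := phi_term m lam d.
have Si : near0_integrable m S by exact: near0_integrable_phi_series.
have ti k : near0_integrable m (t k) by exact: near0_integrable_phi_term.
have [A A0 AP] := phi_series_tail hm lam0 Gd x.
have [Sx _] := AP x x0 (lexx _).
pose e n := fun y => S y - \sum_(1 <= k < n.+1) t k y.
have ei n : near0_integrable m (e n).
  by apply: near0_integrableB => //; exact: near0_integrable_sum.
have E n : lam * dots (dotm m (fun y => lam ^+ d * G m d y + S y)) x =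
    lam * dots (dotm m (e n)) x + \sum_(1 <= k < n.+2) t k x.
  have -> : \sum_(1 <= k < n.+2) t k x =
      lam * dots (dotm m (fun y => \sum_(0 <= k < n.+1) t k y)) x.
    rewrite big_add1/= dots_dotm_sum// mulr_sumr.
    by apply: eq_bigr => k _; rewrite /t phi_termS.
  rewrite -mulrDr -(dots_dotmD (ei n) (near0_integrable_sum _ ti) x0).
  congr (_ * _); apply: eq_dots_dotm => y y0.
  rewrite /e [\sum_(0 <= k < n.+1) t k y]big_ltn// /t {2}/phi_term/= addn0; ring.
have ecvg : lam * dots (dotm m (e n)) x @[n --> \oo] --> (0 : R).
  (* Comes from |K e_n(x)| <= x int |e_n| dm and |e_n(z)| <= A z / 2^n. *)
  pose B := lam * (\int[mu]_(z in `]0, x]) z) * x * A.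
  apply: (@squeeze_cvgr _ _ _ _ (fun n => - (B * 2^-1 ^+ n)) (fun n => B * 2^-1 ^+ n)).
  - apply: nearW => n; rewrite -ler_norml normrM (gtr0_norm lam0) /B exprVn -!mulrA.
    apply: ler_wpM2l; first exact: ltW.
    apply: (le_trans (le_dots_dotm x0 (lexx _) (ei n x))).
    have -> q : \int[mu]_(z in `]0, x]) z * (x * (A * q)) =
      A * q * \int[mu]_(z in `]0, x]) z * x by ring.
    apply: ler_wpM2r => //.
    rewrite -RintegralZl//; last exact: integrable_stieltjes_id.
    apply: le_Rintegral => //.
    + exact: (integrable_norm (ei n x)).
    + by apply: integrable_itvZ; exact: integrable_stieltjes_id.
    + move=> z /=; rewrite in_itv/= => /andP[z0 zx].
      by have [_ /(_ n)] := AP z (ltW z0) zx.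
  - rewrite -oppr0; apply: cvgN.
    by apply: (@cvg_geometric _ B); rewrite ger0_norm// invf_lt1// ltr1n.
  - by apply: (@cvg_geometric _ B); rewrite ger0_norm// invf_lt1// ltr1n.
have c1 : lam * dots (dotm m (e n)) x + \sum_(1 <= k < n.+2) t k x @[n --> \oo]
    --> 0 + S x.
  apply: cvgD => //.
  have : \sum_(1 <= k < n) t k x @[n --> \oo] --> S x by [].
  by rewrite -(cvg_shiftn 2); under eq_fun do rewrite addn2.
rewrite add0r in c1.
rewrite (_ : (fun n : nat => _) =
  cst (lam * dots (dotm m (fun y => lam ^+ d * G m d y + S y)) x)) in c1; last first.
  by apply/funext => n; rewrite -E.
by rewrite -(cvg_lim _ c1)// lim_cst.
Qed.

Lemma phiE x : (0 < d)%N ->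
  phi m lam d x - phi_head m lam d.-1 x = lam ^+ d * G m d x + phi_series m lam d x.
Proof.
case: d => // d' _; rewrite /phi /phi_head /phi_series big_nat_recr//=; ring.
Qed.

Lemma integral_equation_phi : (0 < d)%N ->
  integral_equation m lam d (fun x => phi m lam d x - phi_head m lam d.-1 x).
Proof.
move=> d0; apply/integral_equationP.
have -> : (fun x => phi m lam d x - phi_head m lam d.-1 x) =
    (fun x => lam ^+ d * G m d x + phi_series m lam d x).
  by apply/funext => x; exact: phiE.
split; last first.
  by move=> x x0 /=; rewrite phiE//; congr (_ + _); exact: phi_series_fixpoint.
apply: near0_integrableD; first exact: near0_integrableZ.
exact: near0_integrable_phi_series.
Qed.

End integral_equation.

(** * The boundary value problem *)

(** Fixes a constant of integration from its limit at 0+. *)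
Lemma cvg_right_cst (R : realType) (F : R -> R) (b c l : R) : 0 < b ->
  (forall a, 0 < a -> a < b -> F a = c) -> F a @[a --> 0^'+] --> l -> c = l.
Proof.
move=> b0 Fc Fl.
have cF : F a @[a --> 0^'+] --> c.
  apply: cvg_near_cst; near=> a; apply: Fc.
    by near: a; exact: nbhs_right_gt.
  by near: a; exact: nbhs_right_lt.
by rewrite -(cvg_lim _ cF)// (cvg_lim _ Fl).
Unshelve. all: by end_near. Qed.

Section head.
Context {R : realType} (m : rc_increasing R) (hm : classM m).
Local Notation leb := (@lebesgue_measure R).
Local Notation mu := (stieltjes m).
Implicit Types (f g u v : R -> R) (a b c x y z T C : R) (k n : nat).
Variables (lam : R) (d : nat).
Hypothesis d0 : (0 < d)%N.

Definition head_slope x : R := \sum_(0 <= k < d) lam ^+ k.+1 * - oint m x 1 (G m k).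

Lemma head_slopeE x : 0 < x ->
  lam * tilde m x - \sum_(1 <= k < d) lam ^+ k.+1 * oint m x 1 (G m k) = head_slope x.
Proof.
move=> x0; rewrite /head_slope [RHS]big_ltn// -tildeE// expr1; congr (_ + _).
by rewrite -sumrN; apply: eq_bigr => k _; rewrite mulrN.
Qed.

Lemma integrable_head_slope T : leb.-integrable `]0, T] (EFin \o head_slope).
Proof.
apply: integrable_itv_sum => k; apply: integrable_itvZ; apply: integrable_itvN.
by apply: oint_integrable => //; exact: locally_bounded_G.
Qed.

Lemma head_slope_primitive x :
  \int[leb]_(y in `]0, x]) head_slope y = phi_head m lam d x - 1.
Proof.
have oi k : leb.-integrable `]0, x] (EFin \o (fun y => - oint m y 1 (G m k))).
  by apply: integrable_itvN; apply: oint_integrable => //; exact: locally_bounded_G.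
rewrite Rintegral_itv_sum; last by move=> k; exact: integrable_itvZ.
rewrite /phi_head [RHS]addrAC subrr add0r big_add1/=; apply: eq_bigr => k _.
rewrite RintegralZl//; congr (_ * _); rewrite (GS hm) -[RHS]mulN1r -RintegralZl//.
  by apply: eq_Rintegral => y _; rewrite mulN1r.
by apply: oint_integrable => //; exact: locally_bounded_G.
Qed.

Lemma head_slope_cvgr x : 0 < x -> head_slope y @[y --> x^'+] --> head_slope x.
Proof.
move=> x0; rewrite /head_slope; apply: cvg_big => [|k _]; first exact: add_continuous.
apply: cvgM; first exact: cvg_cst.
by apply: cvgN; apply: oint_cvgr => //; exact: locally_bounded_G.
Qed.

Lemma phi_head_predE x : phi_head m lam d.-1 x = \sum_(0 <= k < d) lam ^+ k * G m k x.
Proof.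
by rewrite /phi_head prednK// [RHS]big_ltn// expr0 mul1r.
Qed.

Lemma phi_head0 : phi_head m lam d 0 = 1.
Proof.
rewrite /phi_head big_add1/= big1 ?addr0// => k _.
by rewrite G0// mulr0.
Qed.

Lemma phi_headE x : phi_head m lam d x = phi_head m lam d.-1 x + lam ^+ d * G m d x.
Proof.
by case: d d0 => // d' _; rewrite /phi_head big_nat_recr//= addrA.
Qed.

Lemma locally_bounded_phi_head : locally_bounded (phi_head m lam d.-1).
Proof.
have -> : phi_head m lam d.-1 = fun x => \sum_(0 <= k < d) lam ^+ k * G m k x.
  by apply/funext => x; exact: phi_head_predE.
move=> T; split.
  apply: measurable_sum => k; apply: measurable_funM; first exact: measurable_cst.
  by have := locally_bounded_measurable (locally_bounded_G hm k); exact.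
elim: (index_iota 0 d) => [|k r [C rC]].
  by exists 0 => x _; rewrite big_nil normr0.
have [_ [B kB]] := locally_bounded_G hm k T.
exists (`|lam ^+ k| * B + C) => x xT; rewrite big_cons (le_trans (ler_normD _ _))//.
by rewrite lerD ?rC// normrM ler_wpM2l// kB.
Qed.

(** The head solves the string equation up to a shift: the slope of the head with d terms is driven
    by the head with d - 1 terms. This is why [phi_head m lam d.-1] is what has to be subtracted
    from u. *)
Lemma head_slopeB a b : 0 < a -> a <= b ->
  head_slope b - head_slope a = lam * \int[mu]_(x in `]a, b]) phi_head m lam d.-1 x.
Proof.
move=> a0 ab.
have Gi k : mu.-integrable `]a, b] (EFin \o G m k).
  by apply: locally_bounded_integrable => //; exact: locally_bounded_G.
under eq_Rintegral do rewrite phi_head_predE.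
rewrite Rintegral_itv_sum; last by move=> k; exact: integrable_itvZ.
rewrite /head_slope -sumrB mulr_sumr; apply: eq_bigr => k _.
rewrite RintegralZl// -(ointB hm a0 ab (locally_bounded_G hm k)) exprS; ring.
Qed.

Hypotheses (lam0 : 0 < lam) (Gd : near0_integrable m (G m d)).

(** The integral equation says that u is 1 plus the integral of [p]. As [p] is right continuous, it
    is the right derivative everywhere on (0, oo), and every claim is read off from it. *)
Lemma string_equation_of_integral u :
  integral_equation m lam d (fun x => u x - phi_head m lam d.-1 x) ->
  string_equation m lam u /\ modified_neumann m lam d u.
Proof.
move=> /integral_equationP[]; set w := (fun x => _) => wi weq.
pose p x := head_slope x + lam * dotm m w x.
have dwi T : leb.-integrable `]0, T] (EFin \o (fun x => lam * dotm m w x)).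
  by apply: integrable_itvZ; exact: integrable_dotm.
have pi T : leb.-integrable `]0, T] (EFin \o p).
  by apply: integrable_itvD => //; exact: integrable_head_slope.
have uE x : 0 <= x -> u x = 1 + \int[leb]_(y in `]0, x]) p y.
  move=> x0; rewrite /p RintegralD//; last exact: integrable_head_slope.
  rewrite head_slope_primitive RintegralZl//; last exact: integrable_dotm.
  have := weq x x0; rewrite /w phi_headE => /eqP; rewrite subr_eq => /eqP ->.
  rewrite /dots; ring.
have u0 : u 0 = 1 by rewrite uE// Rintegral_itv_geC// addr0.
have pr x : 0 < x -> p y @[y --> x^'+] --> p x.
  move=> x0; apply: cvgD; first exact: head_slope_cvgr.
  apply: cvgM; first exact: cvg_cst.
  by apply: (@Rintegral_oc_cvgr _ _ _ _ _ (x + 1)); rewrite ?ltrDl// ltW.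
have rq x : 0 < x -> rquot u x h @[h --> 0^'+] --> p x.
  move=> x0; apply: (@rquot_primitive _ _ _ _ (x + 1)).
  - by rewrite ltrDl.
  - by apply: integrable_subitv (pi (x + 1)) => //; exact: ltW.
  - exact: pr.
  - move=> y xy; rewrite !uE ?(ltW (lt_trans x0 xy)) ?(ltW x0)//.
    by rewrite (Rintegral_itv_cat (ltW x0) (ltW xy) (pi y)); ring.
have rE x : 0 < x -> rderiv u x = p x by move=> x0; apply: cvg_lim => //; exact: rq.
split.
  split.
  - by apply: (continuous_primitive pi) => x x0; rewrite u0 uE.
  - by move=> x x0; apply/cvg_ex; exists (p x); exact: rq.
  - move=> a b a0 ab; have b0 := lt_trans a0 ab.
    have pab : leb.-integrable `]a, b] (EFin \o p).
      by apply: integrable_subitv (pi b) => //; exact: ltW.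
    have re y : y \in [set` `]a, b]] -> p y = rderiv u y.
      move=> /set_mem/=; rewrite in_itv/= => /andP[ay _].
      by rewrite rE// (lt_trans a0).
    split; first by apply: eq_integrable pab => // y yab; rewrite /= re.
    rewrite (uE b (ltW b0)) (uE a (ltW a0)).
    have -> : \int[leb]_(y in `]a, b]) rderiv u y = \int[leb]_(y in `]a, b]) p y.
      by apply: eq_Rintegral => y yab; rewrite re.
    by rewrite (Rintegral_itv_cat (ltW a0) (ltW ab) (pi b)); ring.
  - move=> a b a0 ab; have b0 := lt_trans a0 ab.
    rewrite !rE// /p opprD addrACA head_slopeB ?(ltW ab)//.
    rewrite /dotm (Rintegral_itv_cat (ltW a0) (ltW ab) (wi b)).
    rewrite mulrDr addrAC subrr add0r -mulrDr -RintegralD//.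
    + by congr (_ * _); apply: eq_Rintegral => y _; rewrite /w addrC subrK.
    + by apply: locally_bounded_integrable => //; exact: locally_bounded_phi_head.
    + by apply: integrable_subitv (wi b) => //; exact: ltW.
split=> //.
have : lam * dotm m w x @[x --> 0^'+] --> lam * 0.
  apply: cvgM; first exact: cvg_cst.
  exact: (@Rintegral_oc_cvg0 _ _ _ _ 1).
rewrite mulr0; apply: cvg_trans; apply: near_eq_cvg; near=> x.
have x0 : 0 < x by near: x; exact: nbhs_right_gt.
by rewrite head_slopeE// rE// /p addrAC subrr add0r.
Unshelve. all: by end_near. Qed.

End head.

(** * From the boundary value problem to the integral equation *)

Section converse.
Context {R : realType} (m : rc_increasing R) (hm : classM m).
Local Notation leb := (@lebesgue_measure R).
Local Notation mu := (stieltjes m).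
Implicit Types (f g u v : R -> R) (a b c x y z T C : R) (k n : nat).
Variables (lam : R) (d : nat).
Hypothesis d0 : (0 < d)%N.

Hypotheses (lam0 : 0 < lam) (Gd : near0_integrable m (G m d)).

(** Two integrations from 0+: u(0) = 1 fixes the constant in u - phi_head = int D dx, and the
    Neumann condition fixes it in D = lam int w dm. *)
Lemma integral_of_string_equation u :
  string_equation m lam u -> modified_neumann m lam d u ->
  integral_equation m lam d (fun x => u x - phi_head m lam d.-1 x).
Proof.
move=> [uc _ uprim ujump] [u0 uN].
pose D x := rderiv u x - head_slope m lam d x.
have D0 : D x @[x --> 0^'+] --> (0 : R).
  apply: cvg_trans uN; apply: near_eq_cvg; near=> x.
  by rewrite /D -head_slopeE//; near: x; exact: nbhs_right_gt.
have [delta /= delta0 Ddelta] :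
    exists2 e, 0 < e & forall x, 0 < x -> x <= e -> `|D x| <= 1.
  move/cvgrPdist_le : D0 => /(_ 1 ltr01)[e /= e0 eD].
  exists (e / 2); first by rewrite divr_gt0.
  move=> x x0 xe; have := eD x; rewrite /= !sub0r !normrN; apply => //.
  by rewrite gtr0_norm// (le_lt_trans xe)// ltr_pdivrMr// ltr_pMr// ltr1n.
have ri a b : 0 < a -> leb.-integrable `]a, b] (EFin \o rderiv u).
  move=> a0; have [|ab] := leP b a.
    move=> ba; apply: (@integrable_subitv _ _ _ a (a + 1)) => //.
      by rewrite (le_trans ba)// lerDl.
    by have [] := uprim a (a + 1) a0; rewrite ?ltrDl.
  by have [] := uprim a b a0 ab.
have mD T : measurable_fun `]0, T] D.
  apply: measurable_funB; last first.
    exact: integrable_measurable_fun (integrable_head_slope hm lam d T).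
  (* Measurability of [rderiv u] is given only on intervals away from 0, so []0, T]] is exhausted by
     countably many of them. *)
  rewrite -itv_oc0_bigcup; apply/measurable_fun_bigcup => // n.
  exact: integrable_measurable_fun (ri _ _ _).
have iD T : leb.-integrable `]0, T] (EFin \o D).
  apply: (@integrable_itv_cat _ _ _ _ delta).
    apply: (@le_integrable_itv _ _ _ (cst 1)) => //.
      by move=> x; rewrite in_itv/= => /andP[]; exact: Ddelta.
    exact: integrable_lebesgue_cst.
  apply: integrable_itvB; first exact: ri.
  by apply: integrable_subitv (integrable_head_slope hm lam d T) => //; exact: ltW.
have uDE x : 0 <= x -> u x - phi_head m lam d x = \int[leb]_(y in `]0, x]) D y.
  rewrite le_eqVlt => /predU1P[<-|x0].
    by rewrite u0 phi_head0// subrr Rintegral_itv_geC.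
  apply/eqP; rewrite -subr_eq0; apply/eqP.
  (* Both sides have the same increment over []a, x]], and their difference tends to 0 at 0+. *)
  apply: (@cvg_right_cst _ (fun a => u a - phi_head m lam d a -
    \int[leb]_(y in `]0, a]) D y) x) => //.
    move=> a a0 ax; have [_ uax] := uprim a x a0 ax.
    have hs := integrable_head_slope hm lam d x.
    have : \int[leb]_(y in `]a, x]) rderiv u y =
      \int[leb]_(y in `]a, x]) D y + \int[leb]_(y in `]a, x]) head_slope m lam d y.
      rewrite -RintegralD//; last first.
      - by apply: integrable_subitv hs => //; exact: ltW.
      - by apply: integrable_subitv (iD x) => //; exact: ltW.
      by apply: eq_Rintegral => y _; rewrite /D subrK.
    have := Rintegral_itv_cat (ltW a0) (ltW ax) hs.
    rewrite !head_slope_primitive// => E1.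
    have E2 := Rintegral_itv_cat (ltW a0) (ltW ax) (iD x).
    by rewrite -uax E2; lra.
  suff : u a - phi_head m lam d a - \int[leb]_(y in `]0, a]) D y @[a --> 0^'+] -->
    u 0 - 1 - 0 by rewrite u0 subrr subr0.
  apply: cvgB; last by apply: (@Rintegral_oc_cvg0 _ _ _ _ 1).
  apply: cvgB.
    move/subspace_continuousP : uc => /(_ 0); rewrite /= in_itv/= lexx => /(_ isT) uc0.
    (* Continuity within [[0, +oo[] at 0 implies the limit from the right, since positive points lie
       in that set. *)
    apply: cvg_trans uc0; apply: cvg_app => P.
    have key : nbhs (0 : R) (fun t => `[0, +oo[%classic t -> P t) ->
        nbhs (0 : R) (fun t => 0 < t -> P t).
      by apply: filterS => t Pt t0; apply: Pt; rewrite /= in_itv/= andbT ltW.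
    exact: key.
  have -> : phi_head m lam d =
      (fun a => \int[leb]_(y in `]0, a]) head_slope m lam d y + 1).
    by apply/funext => a; rewrite head_slope_primitive// subrK.
  suff : \int[leb]_(y in `]0, a]) head_slope m lam d y + 1 @[a --> 0^'+] -->
      (0 + 1 : R).
    by rewrite add0r.
  apply: cvgD; last exact: cvg_cst.
  by apply: (@Rintegral_oc_cvg0 _ _ _ _ 1) => //; exact: integrable_head_slope.
set w := (fun x => _).
have wE : w = (fun x => lam ^+ d * G m d x + (u x - phi_head m lam d x)).
  by apply/funext => x; rewrite /w (phi_headE m lam d0); ring.
(* w is lam^d G^d plus the integral of [D]; since |D| <= 1 on []0, delta]], the latter is at most x
   there. *)
have wi : near0_integrable m w.
  rewrite wE; apply: near0_integrableD; first exact: near0_integrableZ.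
  apply: (@near0_integrable_bound _ _ hm _ delta 1) => //.
    exact: (@locally_bounded_primitive _ _ D).
  move=> x; rewrite in_itv/= => /andP[x0 xd]; rewrite uDE ?(ltW x0)//.
  rewrite -[X in 1 * X]subr0; apply: le_Rintegral_lebesgue_cst => //; first exact: ltW.
  by move=> y; rewrite in_itv/= => /andP[y0 yx]; rewrite Ddelta// (le_trans yx).
have Dw b : 0 < b -> D b = lam * dotm m w b.
  move=> b0; apply/eqP; rewrite -subr_eq0; apply/eqP.
  apply: (@cvg_right_cst _ (fun a => D a - lam * dotm m w a) b) => //.
    move=> a a0 ab; have := ujump a b a0 ab.
    have -> : \int[mu]_(x in `]a, b]) u x = \int[mu]_(x in `]a, b]) w x +
        \int[mu]_(x in `]a, b]) phi_head m lam d.-1 x.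
      rewrite -RintegralD//.
      - by apply: eq_Rintegral => y _; rewrite /w subrK.
      - by apply: integrable_subitv (wi b) => //; exact: ltW.
      - by apply: locally_bounded_integrable => //; exact: locally_bounded_phi_head.
    have := head_slopeB hm lam d0 a0 (ltW ab).
    rewrite /D /dotm (Rintegral_itv_cat (ltW a0) (ltW ab) (wi b)) !mulrDr; lra.
  suff : D a - lam * dotm m w a @[a --> 0^'+] --> 0 - lam * 0.
    by rewrite mulr0 subr0.
  apply: cvgB => //; apply: cvgM; first exact: cvg_cst.
  exact: (@Rintegral_oc_cvg0 _ _ _ _ 1).
apply/integral_equationP; split=> // x x0.
rewrite {1}wE; congr (_ + _); rewrite uDE// /dots -RintegralZl//; last first.
  exact: integrable_dotm.
by apply: eq_Rintegral => y /set_mem/=; rewrite in_itv/= => /andP[y0 _]; exact: Dw.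
Unshelve. all: by end_near. Qed.

End converse.

Theorem proposition2p7 (R : realType) (m : rc_increasing R) (d : nat) (lam : R)
    (hm : classM m) (hfin : (sindex m < +oo)%E)
    (hd : (maxe (sindex m) 1 <= d%:R%:E)%E) (hlam : 0 < lam) :
  (forall K : set R, compact K -> K `<=` `[0, +oo[ ->
     {uniform K,
       (fun (n : nat) (x : R) =>
          phi_head m lam d x + \sum_(1 <= k < n) phi_term m lam d k x) @ \oo
       --> phi m lam d}) /\
  unique_solution (integral_equation m lam d)
    (fun x => phi m lam d x - phi_head m lam d.-1 x) /\
  unique_solution
    (fun u => string_equation m lam u /\ modified_neumann m lam d u)
    (phi m lam d) /\
  (forall u : R -> R,
     integral_equation m lam d (fun x => u x - phi_head m lam d.-1 x) <->
     string_equation m lam u /\ modified_neumann m lam d u).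
Proof.
have d0 : (0 < d)%N.
  by move: hd; rewrite ge_max lee_fin ler1n => /andP[].
have Gd : near0_integrable m (G m d).
  by move=> T; apply: integrable_G_cat => //; exact: integrable_G.
have ieq := integral_equation_phi hm hlam Gd d0.
have stringP u : integral_equation m lam d (fun x => u x - phi_head m lam d.-1 x) <->
    string_equation m lam u /\ modified_neumann m lam d u.
  split; first exact: string_equation_of_integral.
  by move=> [? ?]; exact: integral_of_string_equation.
split; first by move=> K; exact: cvg_uniform_phi.
split.
  by split=> // v veq x x0; have := integral_equation_unique hm hlam ieq veq x0.
split; last exact: stringP.
split; first exact/stringP.
move=> v /stringP veq x x0; apply: (addIr (- phi_head m lam d.-1 x)).
by have := integral_equation_unique hm hlam ieq veq x0.
Qed.
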